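(* Suppose $\ell>1$ and let $X$ be the module afforded by a Weil representation of $\mathrm{U}=\mathrm{U}(V,h)$ of type $\lambda$, where $\lambda$ is a primitive linear character of $R^+$. Then the irreducible constituents of the $\mathrm{U}$-module $\mathrm{Top}=X/\mathrm{Bot}$ are the $|N|=2q^{\ell-1}$ eigenspaces $\mathrm{Top}(\phi)$, $\phi\in\mathrm{Irr}(N)$, for the action of $N$; and, up to multiplication by a linear character of $\mathrm{U}$, the remaining $2(q^{\ell-2}+\cdots+q+1)$ irreducible constituents of $X$ are the irreducible constituents of $\mathrm{Bot}$ viewed as a Weil module (of primitive type) for the unitary group $\overline{\mathrm{U}}$, inflated to $\mathrm{U}$.
   Context: Rings. Let $\mathcal{O}$ be a local principal ideal domain that is not a field, with maximal ideal $\mathcal{O}s$ and finite residue field $F_q$ of odd characteristic. Let $\mathcal{R}=\mathcal{O}[X]/(X^2-s)=\mathcal{O}\oplus\mathcal{O}t$, $t^2=s$, with the involution fixing $\mathcal{O}$ elementwise and sending $t\mapsto -t$. Fix $\ell\ge 1$ and set $A=\mathcal{R}/\mathcal{R}t^{2\ell-1}$, $R=\mathcal{O}/\mathcal{O}s^{\ell}$. Let $\pi$ be the image of $t$ in $A$, $p$ the image of $s$ in $R$, $\mathfrak{r}=A\pi$, $\mathfrak{m}=Rp$. Then $R$ embeds in $A$, $A=R\oplus R\pi$, $\pi^2=p$, and $A$ has an induced involution $*$ fixing $R$ elementwise and sending $\pi\mapsto-\pi$. Put $\mathfrak{n}=\mathfrak{m}^{\ell-1}=\mathfrak{r}^{2\ell-2}$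 (the minimal ideal of both $R$ and $A$) and $N=\{a\in A^\times\mid aa^*=1\}$. Forms. $V$ is a free $A$-module of rank $2n$, $n\ge 1$, and $h:V\times V\to A$ is a nondegenerate skew hermitian form: $h$ is $A$-linear in the second variable, $*$-linear in the first, $h(v,u)=-h(u,v)^*$, and $u\mapsto h(u,-)$ is an injective map $V\to\mathrm{Hom}_A(V,A)$. $\mathrm{U}=\mathrm{U}(V,h)$ is the group of all $g\in\mathrm{GL}_A(V)$ preserving $h$; $N$ is viewed as a central subgroup of $\mathrm{U}$ via $a\mapsto a\cdot 1_V$. The alternating form associated to $h$ is $f(v,w)=\frac{h(v,w)+h(v,w)^*}{2}\in R$, a nondegenerate alternating $R$-bilinear form on $V$. $\mathrm{Sp}=\mathrm{Sp}(V,f)$ is the group of all $g\in\mathrm{GL}_R(V)$ preserving $f$; thus $\mathrm{U}\le\mathrm{Sp}$. Weil representations. A linear character $\lambda:R^+\to\mathbb{C}^\times$ is primitive if its kernel contains no nonzero ideal of $R$. The Heisenberg group is $H=R\times V$ with $(r,u)(s,v)=(r+s+f(u,v),u+v)$ and center $(R,0)$, identified with $R^+$. Up to isomorphism $H$ has a unique irreducible complex representation $S:H\to\mathrm{GL}(X)$ on which $(R,0)$ acts via $\lambda$ (Schrödinger representation of type $\lambda$). For a subgroup $G\le\mathrm{Sp}$, a Weil representation of $G$ of type $\lambda$ is any representation $W:G\to\mathrm{GL}(X)$ with $W(g)S(r,u)W(g)^{-1}=S(r,gu)$ for all $g\in G$, $(r,u)\in H$. (Such representations exist, and any two differ by a linear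 character of $G$.) Layers. $\mathrm{Bot}=\{x\in X\mid S(0,w)x=x\text{ for all }w\in\mathfrak{n}V\}$, a $\mathrm{U}$-submodule of $X$; $\mathrm{Top}=X/\mathrm{Bot}$; for $\phi\in\mathrm{Irr}(N)$, $\mathrm{Top}(\phi)=\{y\in\mathrm{Top}\mid ay=\phi(a)y\text{ for all }a\in N\}$. Quotients ($\ell>1$). $\overline{A}=A/\mathfrak{r}^{2\ell-3}$ with the induced involution, $\overline{R}=R/\mathfrak{m}^{\ell-1}$, $\overline{V}=V/\mathfrak{r}^{2\ell-3}V$, a free $\overline{A}$-module of rank $2n$, $\overline{h}$ the nondegenerate skew hermitian form on $\overline{V}$ induced by $h$, and $\overline{\mathrm{U}}$ its unitary group; the natural map $\mathrm{U}\to\overline{\mathrm{U}}$ is surjective. Let $\overline{f}:\overline{V}\times\overline{V}\to\overline{R}$ be the alternating form induced by $f$, and let $\overline{H}=\overline{R}\times\overline{V}$ be the Heisenberg group with multiplication $(a,x)(b,y)=(a+b+\overline{f}(x,y),x+y)$ and center $(\overline{R},0)$, identified with $\overline{R}^+$. A linear character $\mu:\overline{R}^+\to\mathbb{C}^\times$ is primitive if its kernel contains no nonzero ideal of $\overline{R}$. A Weil representation of $\overline{\mathrm{U}}$ of primitive type $\mu$ is any representation $\overline{W}:\overline{\mathrm{U}}\to\mathrm{GL}(Y)$, where $Y$ carries an irreducible complex representation $\overline{S}:\overline{H}\to\mathrm{GL}(Y)$ on which $(\overline{R},0)$ acts via $\mu$ (such $\overline{S}$ is unique up to isomorphism), with $\overline{W}(g)\overline{S}(a,x)\overline{W}(g)^{-1}=\overline{S}(a,gx)$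 for all $g\in\overline{\mathrm{U}}$, $(a,x)\in\overline{H}$. *)

(* Defs.v *)
From HB Require Import structures.
From mathcomp Require Import all_boot all_order all_fingroup all_algebra.
From mathcomp Require Import qpoly mxrepresentation.

Set Implicit Arguments.
Unset Strict Implicit.
Unset Printing Implicit Defensive.

Import GRing.Theory.
Local Open Scope ring_scope.

(* Modules are right modules, as in mxrepresentation and perm: a matrix       *)
(* representation acts on row vectors by v |-> v *m rG g, and in {perm V} the *)
(* product g * g' is "first g, then g'". A left-handed setting is turned into *)
(* this one by transposing all matrices and replacing h by - h.               *)

Section CommutativeAlgebra.

Definition ideal (B : comNzRingType) (I : B -> Prop) : Prop :=
  [/\ I 0, forall x y, I x -> I y -> I (x + y) & forall a x, I x -> I (a * x)].

Definition principal (B : comNzRingType) (b x : B) : Prop :=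
  exists y, x = y * b.

Definition maximal_ideal (B : comNzRingType) (I : B -> Prop) : Prop :=
  [/\ ideal I, ~ I 1 &
      forall J : B -> Prop, ideal J -> ~ J 1 -> (forall x, I x -> J x) ->
        forall x, J x -> I x].

Definition local_with_maximal (B : comNzRingType) (s : B) : Prop :=
  forall I : B -> Prop, maximal_ideal I <-> (forall x, I x <-> principal s x).

Definition principal_ideal_ring (B : comNzRingType) : Prop :=
  forall I : B -> Prop, ideal I -> exists b, forall x, I x <-> principal b x.

(* f exhibits C as the quotient ring B / Bb. *)
Definition is_quotient (B C : comNzRingType) (f : B -> C) (b : B) : Prop :=
  (forall y, exists x, f x = y) /\ (forall x, f x = 0 <-> principal b x).

End CommutativeAlgebra.

Section Characters.
Variable C : numClosedFieldType.

Definition additive_char (B : comNzRingType) (lambda : B -> C) : Prop :=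
  lambda 0 = 1 /\ (forall a b, lambda (a + b) = lambda a * lambda b).

Definition primitive_char (B : comNzRingType) (lambda : B -> C) : Prop :=
  additive_char lambda /\
  forall I : B -> Prop, ideal I -> (forall x, I x -> lambda x = 1) ->
    forall x, I x -> x = 0.

Definition lin_char (gT : finGroupType) (G : {group gT}) (chi : gT -> C) :
    Prop :=
  chi 1%g = 1 /\ {in G &, {morph chi : x y / (x * y)%g >-> x * y}}.

End Characters.

Section Unitary.
Variables (A : finComNzRingType) (m : nat).
Local Notation V := 'rV[A]_m.
Variable h : V -> V -> A.

Definition skew_hermitian (star : {rmorphism A -> A}) : Prop :=
  [/\ forall u, linear_for *%R (h u),
      forall v, linear_for (star \; *%R) (h^~ v)
    & forall u v, h v u = - star (h u v)].

Definition nondegenerate_form : Prop := forall u u', h u =1 h u' -> u = u'.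

Definition unitary : {set {perm V}} :=
  [set g : {perm V} |
     [forall a, forall u, forall v, g (a *: u + v) == a *: g u + g v]
     && [forall u, forall v, h (g u) (g v) == h u v]].

Lemma unitaryP (g : {perm V}) :
  reflect ((forall a u v, g (a *: u + v) = a *: g u + g v) /\
           (forall u v, h (g u) (g v) = h u v)) (g \in unitary).
Proof.
rewrite inE; apply: (iffP andP) => -[gL gh]; split.
- by move=> a u v; apply/eqP; move/forallP/(_ a)/forallP/(_ u)/forallP/(_ v): gL.
- by move=> u v; apply/eqP; move/forallP/(_ u)/forallP/(_ v): gh.
- by do 3 apply/forallP => ?; apply/eqP.
- by do 2 apply/forallP => ?; apply/eqP.
Qed.

Lemma unitary_group_set : group_set unitary.
Proof.
apply/group_setP; split=> [|g k /unitaryP[gL gh] /unitaryP[kL kh]].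
  by apply/unitaryP; split=> *; rewrite !perm1.
apply/unitaryP; split=> [a u v|u v]; rewrite !permM; last by rewrite kh gh.
by rewrite gL kL.
Qed.
Canonical unitary_group := Group unitary_group_set.

End Unitary.

Section NormOne.
Variables (A : finComNzRingType) (star : {rmorphism A -> A}).

(* a * star a = 1 makes a a unit *)
Definition norm_one : {set A} := [set a | a * star a == 1].

Definition norm_one_scalars (m : nat) : {set {perm 'rV[A]_m}} :=
  [set g : {perm 'rV[A]_m} |
     [exists a, (a \in norm_one) && [forall v, g v == a *: v]]].

Lemma norm_one_scalarsP m (g : {perm 'rV[A]_m}) :
  reflect (exists2 a, a \in norm_one & forall v, g v = a *: v)
          (g \in norm_one_scalars m).
Proof.
rewrite inE; apply: (iffP existsP) => [[a /andP[Na /forallP ga]]|[a Na ga]].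
  by exists a => // v; apply/eqP.
by exists a; rewrite Na; apply/forallP => v; rewrite ga.
Qed.

Lemma norm_one_group_set m : group_set (norm_one_scalars m).
Proof.
apply/group_setP; split=> [|g k].
  apply/norm_one_scalarsP; exists 1; first by rewrite inE rmorph1 mulr1.
  by move=> v; rewrite perm1 scale1r.
move=> /norm_one_scalarsP[a Na ga] /norm_one_scalarsP[b Nb kb].
apply/norm_one_scalarsP; exists (b * a).
  rewrite !inE in Na Nb *.
  by rewrite rmorphM mulrACA (eqP Na) (eqP Nb) mulr1.
by move=> v; rewrite permM ga kb scalerA.
Qed.
Canonical norm_one_group m := Group (norm_one_group_set m).

End NormOne.

Section Heisenberg.
Variables (R V : zmodType).

(* Alternating biadditive maps, which is all that the Heisenberg group needs;  *)
(* an R-module structure on V plays no part.                                  *)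
Record altForm := AltForm {
  alt_fun :> V -> V -> R;
  alt_addl : forall u v w, alt_fun (u + v) w = alt_fun u w + alt_fun v w;
  alt_addr : forall u v w, alt_fun u (v + w) = alt_fun u v + alt_fun u w;
  alt_diag : forall u, alt_fun u u = 0
}.

End Heisenberg.

Definition heisenberg (R V : finZmodType) (f : altForm R V) : Type :=
  (R * V)%type.

HB.instance Definition _ (R V : finZmodType) (f : altForm R V) :=
  Finite.copy (heisenberg f) (R * V)%type.

Section HeisenbergGroup.
Variables (R V : finZmodType) (f : altForm R V).
Local Notation H := (heisenberg f).

Definition heis_mul (x y : H) : H := (x.1 + y.1 + f x.2 y.2, x.2 + y.2).
Definition heis_one : H := (0, 0).
Definition heis_inv (x : H) : H := (- x.1, - x.2).

Lemma heis_mulA : associative heis_mul.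
Proof.
move=> [a u] [b v] [c w]; rewrite /heis_mul /= addrA alt_addr alt_addl.
congr (_, _); rewrite -!addrA; congr (_ + (_ + _)).
by rewrite [RHS]addrCA; congr (_ + _); rewrite addrC -addrA.
Qed.

Lemma heis_mul1 : left_id heis_one heis_mul.
Proof.
move=> [a u]; rewrite /heis_mul /= !add0r; congr (_, _).
by rewrite -[RHS]addr0; congr (_ + _); apply: (addrI (f 0 u));
  rewrite -alt_addl addr0 addr0.
Qed.

Lemma heis_mulV : left_inverse heis_one heis_inv heis_mul.
Proof.
move=> [a u]; rewrite /heis_mul /= !addNr add0r; congr (_, _).
apply: (addIr (f u u)); rewrite -alt_addl addNr alt_diag addr0.
by apply: (addrI (f 0 u)); rewrite -alt_addl addr0 addr0.
Qed.

HB.instance Definition _ :=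
  Finite_isGroup.Build H heis_mulA heis_mul1 heis_mulV.

Definition heis (r : R) (u : V) : H := (r, u).

Lemma heisM r s u v : (heis r u * heis s v)%g = heis (r + s + f u v) (u + v).
Proof. by []. Qed.

End HeisenbergGroup.

Section Weil.
Variables (C : numClosedFieldType) (R V : finZmodType) (f : altForm R V).
Variable d : nat.
Variable S : mx_representation C [set: heisenberg f] d.

Definition schrodinger (lambda : R -> C) : Prop :=
  mx_irreducible S /\ forall r, S (heis f r 0) = (lambda r)%:M.

Definition weil (G : {group {perm V}}) (W : mx_representation C G d) : Prop :=
  forall g, g \in G -> forall r u,
    invmx (W g) *m S (heis f r u) *m W g = S (heis f r (g u)).

Definition fixed_by (B : {set V}) : 'M[C]_d :=
  rfix_mx S [set heis f 0 w | w in B].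

End Weil.

Section Modules.
Variables (C : numClosedFieldType) (gT : finGroupType) (G : {group gT}).

(* For N abelian, irr_mode phi is the linear character afforded by phi. *)
Definition Irr (N : {group gT}) : irrType C N :=
  DecSocleType (regular_repr C N).

Definition joint_eigenspace d (rG : mx_representation C G d) (N : {set gT})
    (phi : gT -> C) : 'M[C]_d :=
  (\bigcap_(a in N) eigenspace (rG a) (phi a))%MS.

(* M is the direct sum of the pairwise nonisomorphic simple submodules B i. *)
Definition mult_free_decomposition d (rG : mx_representation C G d)
    (M : 'M[C]_d) (I : finType) (B : I -> 'M[C]_d) : Prop :=
  [/\ forall i, mxsimple rG (B i),
      (\sum_i B i :=: M)%MS,
      mxdirect (\sum_i B i)%MS
    & forall i j, mx_iso rG (B i) (B j) -> i = j].

End Modules.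

(* Main.v *)
Require Import Defs.
From HB Require Import structures.
From mathcomp Require Import all_boot all_order all_fingroup all_algebra.
From mathcomp Require Import center pgroup qpoly mxrepresentation.
From mathcomp Require Import ring zify.

Set Implicit Arguments.
Unset Strict Implicit.
Unset Printing Implicit Defensive.

Import GRing.Theory Num.Theory.
Local Open Scope ring_scope.

(* S = Schrodinger representation, T v = S (0, v), commutant = End_U(X).

   Upper bound. The T v span End(X), so averaging over U shows that the
   dimension of the commutant is at most the number of U-orbits on V. Primitive
   vectors of equal length are conjugate under U: reflections carry v to w when
   h(v, w) is a unit, and in general one passes through a third vector. Hence
   every v is conjugate to 0 or to pi^k (e + x f) with (e, f) a hyperbolic pair
   and x skew, which gives at most 2 (1 + q + ... + q^(l-1)) orbits.

   Lower bound. The vectors fixed by r^(2l-1-i) V, for 0 <= i < l, form a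
   decreasing chain of submodules of X; the layer i = 0 is Top. Let x be fixed by
   r^i f + r^(2l-1-i) V and be an eigenvector of N. The vectors x T(a pi^i e),
   a in N, lie in the i-th layer, are permuted by N up to scalars, and belong to
   distinct characters of r^i f for distinct a pi^(2i); so at least
   |N pi^(2i)| >= 2 q^(l-1-i) characters of N occur in the i-th layer.

   The (layer, character of N) pieces of X are thus at least as many as the
   dimension of the commutant, which forces them to be simple and pairwise
   nonisomorphic.

   Bot is irreducible under the operators T (pi v), which make it a Schrodinger
   representation of the Heisenberg group of V / r^(2l-3) V, of type
   r |-> lambda (- p r). A Weil representation of the quotient unitary group
   exists: v |-> - v acts with eigenspaces of dimensions differing by one, so
   that intertwiners can be normalized to have equal determinants on both. By
   Schur's lemma U acts on Bot through it up to a linear character. *)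

(** * Idempotents and commutants *)

Section Idempotents.
Variables (F : fieldType) (d : nat).

(** Bases of the column and row spaces factor P as L B with L left invertible and B right
    invertible; cancelling both in L B L B = L B leaves B L = 1. *)
Lemma idempotent_factor (P : 'M[F]_d) : P *m P = P ->
  exists L (B : 'M[F]_(\rank P, d)), P = L *m B /\ B *m L = 1%:M.
Proof.
move=> PP; exists (col_base P), (row_base P); rewrite mulmx_base; split=> //.
have := row_base_free P; have := col_base_full P; have := mulmx_base P.
move: (\rank P) (col_base P) (row_base P) => r L B defP.
move: PP; rewrite -defP => PP /row_fullP[L' LL'] /row_freeP[B' BB'].
have := congr1 (fun X => L' *m X *m B') PP.
by rewrite !mulmxA LL' mul1mx -!mulmxA BB' !mulmx1.
Qed.

Lemma mxtrace_idempotent (P : 'M[F]_d) : P *m P = P -> \tr P = (\rank P)%:R.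
Proof.
move=> /idempotent_factor[L [B [PLB BL]]].
by rewrite [in LHS]PLB mxtrace_mulC BL mxtrace1.
Qed.

(** Sylvester's determinant identity, from two block triangular factorizations of one matrix. *)
Lemma det_addmx_mulmx r (L : 'M[F]_(d, r)) (B : 'M[F]_(r, d)) :
  \det (1%:M + L *m B) = \det (1%:M + B *m L).
Proof.
have e1 : block_mx 1%:M (- L) B 1%:M
          = block_mx 1%:M 0 B 1%:M *m block_mx 1%:M (- L) 0 (1%:M + B *m L).
  rewrite mulmx_block !mul1mx !mul0mx ?mulmx0 ?addr0 ?mulmx1 !mulmxN.
  by rewrite addrCA addNr addr0.
have e2 : block_mx 1%:M (- L) B 1%:M
          = block_mx 1%:M (- L) 0 1%:M *m block_mx (1%:M + L *m B) 0 B 1%:M.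
  rewrite mulmx_block !mul1mx !mul0mx ?mulmx0 ?addr0 ?mulmx1 !mulNmx.
  by rewrite !add0r addrK.
have := e1; rewrite e2 => /(congr1 determinant).
by rewrite !det_mulmx !det_ublock !det_lblock !det1 !mul1r mulr1.
Qed.

Lemma det_scale_idempotent (P : 'M[F]_d) (c : F) : P *m P = P ->
  \det (c *: P + (1%:M - P)) = c ^+ \rank P.
Proof.
move=> /idempotent_factor[L [B [PLB BL]]].
have -> : c *: P + (1%:M - P) = 1%:M + ((c - 1) *: L) *m B.
  by rewrite -scalemxAl -PLB scalerBl scale1r addrCA.
rewrite det_addmx_mulmx -scalemxAr BL -[X in X + _]scale1r -scalerDl.
by rewrite addrC subrK detZ det1 mulr1.
Qed.

(** When Q commutes with the idempotent P, this is the determinant of Q on the image of P; the term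
    1 - P fills the complement with the identity. *)
Definition det_on (P Q : 'M[F]_d) := \det (P *m Q + (1%:M - P)).

Lemma det_onM (P Q Q' : 'M[F]_d) : P *m P = P -> comm_mx P Q ->
  det_on P (Q *m Q') = det_on P Q * det_on P Q'.
Proof.
move=> PP cPQ; rewrite /det_on -det_mulmx; congr (\det _).
have PQP : P *m Q *m P = P *m Q by rewrite cPQ -mulmxA PP.
rewrite mulmxDl !mulmxDr !mulmxA PQP mulmxBl mul1mx PP subrr mul0mx add0r.
by rewrite !mulmxN !mulmx1 PQP subrr addr0 mulmxBl PP mul1mx subrr subr0.
Qed.

Lemma det_onZ (P Q : 'M[F]_d) (c : F) : P *m P = P -> comm_mx P Q ->
  det_on P (c *: Q) = c ^+ \rank P * det_on P Q.
Proof.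
move=> PP cPQ; rewrite -det_scale_idempotent // -[c *: Q]mul1mx -scalemxAr.
rewrite scalemxAl det_onM //; first by rewrite /det_on -scalemxAr mulmx1.
by rewrite /comm_mx -scalemxAr -scalemxAl mulmx1 mul1mx.
Qed.

Lemma det_on_neq0 (P Q : 'M[F]_d) : P *m P = P -> comm_mx P Q ->
  Q \in unitmx -> det_on P Q != 0.
Proof.
move=> PP cPQ uQ; have /eqP : det_on P (Q *m invmx Q) = 1.
  by rewrite mulmxV // /det_on mulmx1 addrC subrK det1.
by rewrite det_onM //; apply: contraTneq => ->; rewrite mul0r eq_sym oner_eq0.
Qed.

End Idempotents.

Section OrthogonalIdempotents.
Variables (F : fieldType) (d : nat) (I : finType) (E : I -> 'M[F]_d).
Hypothesis EE : forall i j, E i *m E j = E i *+ (i == j).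

Lemma idem_id i : E i *m E i = E i. Proof. by rewrite EE eqxx. Qed.

Lemma idem_sub m (X : 'M_(m, d)) i : (X <= E i)%MS = (X *m E i == X).
Proof.
apply/idP/eqP=> [/submxP[D ->]|<-]; last exact: submxMl.
by rewrite -mulmxA idem_id.
Qed.

(** A vector common to one image and the sum of the others is both fixed and killed by [E i]. *)
Lemma mxdirect_idem (P : pred I) : mxdirect (\sum_(i | P i) E i)%MS.
Proof.
apply/mxdirect_sumsP=> i Pi; apply/eqP; rewrite -submx0.
set W := (_ :&: _)%MS.
have /eqP <- : W *m E i == W by rewrite -idem_sub capmxSl.
have : (W <= kermx (E i))%MS.
  rewrite (submx_trans (capmxSr _ _)) //; apply/sumsmx_subP=> j /andP[_ ji].
  by apply/sub_kermxP; rewrite EE (negPf ji).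
by move/sub_kermxP->; rewrite submx0.
Qed.

Lemma sumsmx_idem (P : pred I) (S : 'M[F]_d) :
  S = \sum_(i | P i) E i -> (\sum_(i | P i) E i :=: S)%MS.
Proof.
move=> defS; apply/eqmxP/andP; split.
  apply/sumsmx_subP=> i Pi; suff <- : E i *m S = E i by apply: submxMl.
  rewrite defS mulmx_sumr (bigD1 i) //= idem_id big1 ?addr0 // => j /andP[_ ji].
  by rewrite EE eq_sym (negPf ji).
by rewrite defS; apply: summx_sub_sums => i _; apply: submx_refl.
Qed.

End OrthogonalIdempotents.

(** * Decreasing chains of commuting idempotents *)

Section Layers.
Variables (F : fieldType) (d : nat) (P : nat -> 'M[F]_d).
Hypothesis PP : forall i j, P i *m P j = P (maxn i j).

(** The rule with [maxn] makes the images of the [P i] decrease; a layer projects onto a complement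
    of the image of [P i.+1] in that of [P i]. *)
Definition layer i := P i - P i.+1.

Lemma mul_layer_proj i j : layer i *m P j = if (j <= i)%N then layer i else 0.
Proof.
rewrite mulmxBl !PP; case: leqP => [ji|ij].
  by rewrite (maxn_idPl (leqW ji)).
by rewrite (maxn_idPr ij) subrr.
Qed.

Lemma mul_layer i j : layer i *m layer j = layer i *+ (i == j).
Proof.
rewrite mulmxBr !mul_layer_proj; case: ltngtP => _; rewrite ?subrr //.
by rewrite subr0.
Qed.

Lemma sum_layer m n : (m <= n)%N -> \sum_(m <= i < n) layer i = P m - P n.
Proof.
move=> mn; rewrite -(opprB (P n)) -telescope_sumr // -sumrN.
by apply: eq_bigr => i _; rewrite opprB.
Qed.

End Layers.

(** * Simplicity and non-isomorphism from the size of the commutant *)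

Section Commutant.
Variables (F : fieldType) (gT : finGroupType) (G : {group gT}) (d : nat).
Variable rG : mx_representation F G d.
Hypothesis F'G : ([pchar F]^'.-group G)%g.

Definition commutes (X : 'M[F]_d) := forall g, g \in G -> X *m rG g = rG g *m X.

Variables (I : finType) (E : I -> 'M[F]_d).
Hypothesis EE : forall i j, E i *m E j = E i *+ (i == j).
Hypothesis E_comm : forall i, commutes (E i).

Section Dimension.
Variables (k : nat) (T : 'M[F]_(k, d * d)).
Hypothesis T_span : forall X, commutes X -> (mxvec X <= T)%MS.

Let J := [set i | E i != 0].
Let M := \matrix_(i < #|J|) mxvec (E (enum_val i)).

(** Multiplying a linear relation by one [E j] isolates its coefficient. *)
Lemma idem_rows_free : row_free M.
Proof.
apply: inj_row_free => v /(congr1 vec_mx); rewrite linear0 mulmx_sum_row.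
rewrite linear_sum /= => v0; apply/rowP => j; rewrite mxE.
have := congr1 (mulmx^~ (E (enum_val j))) v0; rewrite mul0mx mulmx_suml.
rewrite (bigD1 j) //= big1 => [|i' nij].
  rewrite addr0 linearZ /= rowK mxvecK -scalemxAl EE eqxx /= => /eqP.
  by rewrite scaler_eq0; have := enum_valP j; rewrite inE => /negPf-> /orP[/eqP|].
rewrite linearZ /= rowK mxvecK -scalemxAl EE.
by rewrite (inj_eq enum_val_inj) (negPf nij) scaler0.
Qed.

Let sMT : (M <= T)%MS.
Proof. by apply/row_subP => j; rewrite rowK T_span //; apply: E_comm. Qed.

Lemma card_idem_le : (#|[set i | E i != 0%R]| <= k)%N.
Proof.
by rewrite -(eqnP idem_rows_free) (leq_trans (mxrankS sMT)) // rank_leq_row.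
Qed.

Hypothesis E_many : (k <= #|[set i | E i != 0%R]|)%N.

(** Once there are at least k nonzero idempotents, they span the commutant; multiplication by [E i]
    then keeps a single coefficient of X. *)
Lemma commutant_scalar X i : commutes X -> exists c, E i *m X = c *: E i.
Proof.
move=> cX; have sTM : (T <= M)%MS.
  rewrite -(mxrank_leqif_sup sMT) eqn_leq mxrankS //=.
  by rewrite (eqnP idem_rows_free) (leq_trans (rank_leq_row _)).
have /submxP[D /(congr1 vec_mx)] := submx_trans (T_span cX) sTM.
rewrite mxvecK mulmx_sum_row linear_sum => ->.
exists (\sum_j D 0 j *+ (i == enum_val j)).
rewrite mulmx_sumr scaler_suml; apply: eq_bigr => j _.
rewrite linearZ /= rowK mxvecK -scalemxAr EE.
by case: eqP => // _; rewrite scaler0 scale0r.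
Qed.

End Dimension.

Hypothesis scalarE : forall X i, commutes X -> exists c, E i *m X = c *: E i.

(** Maschke gives an equivariant projection onto a nonzero submodule U of [E i]. It acts on [E i] by
    a scalar, which is 1 because U is fixed, so [E i] lies in U. *)
Lemma commutant_simple i : E i != 0 -> mxsimple rG (E i).
Proof.
move=> nzE; split=> // [|U modU sUE nzU].
  apply/mxmoduleP => g Gg; rewrite E_comm //; exact: submxMl.
have [W modW defW dxW] := mx_Maschke_pchar rG F'G modU (submx1 U).
pose p := proj_mx U W; have UW0 : (U :&: W = 0)%MS by apply/mxdirect_addsP.
have cp : commutes p.
  move=> g Gg.
  have /hom_mxP/(_ g Gg) : (1%:M <= dom_hom_mx rG p)%MS.
    by apply: submx_trans (proj_mx_hom UW0 modU modW); rewrite defW.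
  by rewrite !mul1mx.
have [c Ep] := scalarE i cp.
have [D defU] := submxP sUE.
have : U *m p = c *: U by rewrite {1}defU -mulmxA Ep -scalemxAr -defU.
rewrite proj_mx_id // => /eqP; rewrite -subr_eq0 -[X in X - _]scale1r -scalerBl.
rewrite scaler_eq0 (negPf nzU) orbF subr_eq0 => /eqP c1.
by rewrite -[E i]scale1r c1 -Ep proj_mx_sub.
Qed.

(** For an isomorphism f, [E i *m f] commutes with G and so is a multiple of [E i], while its image
    lies in [E j]. If i and j differ it vanishes, and [E i] with it. *)
Lemma commutant_iso i j : E i != 0 -> mx_iso rG (E i) (E j) -> i = j.
Proof.
move=> nzE [f uf homf defEj]; apply/eqP; apply: contraR nzE => nij.
have cX : commutes (E i *m f).
  move=> g Gg; have /hom_mxP/(_ g Gg) <- := homf.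
  by rewrite E_comm // mulmxA.
have [c] := scalarE i cX; rewrite mulmxA idem_id // => EfcE.
have : E i *m f *m E j = E i *m f.
  by apply/eqP; rewrite -idem_sub // defEj.
rewrite EfcE -scalemxAl EE (negPf nij) scaler0 -EfcE => /esym/eqP.
by move=> /eqP Ef0; rewrite -(mulmxK uf (E i)) Ef0 mul0mx.
Qed.

End Commutant.

(** * Characters of an abelian subgroup *)

Lemma pgroup_pchar_num (C : numFieldType) (gT : finGroupType) (G : {group gT}) :
  ([pchar C]^'.-group G)%g.
Proof.
by apply/pgroupP => p _ _; rewrite inE /= pchar_num.
Qed.

Section LinearCharacters.
Variables (C : numClosedFieldType) (gT : finGroupType) (G N : {group gT}).
Hypotheses (cNN : abelian N) (sNG : N \subset G).
Local Notation irr := (irr_mode (sG := Irr C N)).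

Let splitN : group_splitting_field C N := @group_closure_closed_field C gT N.
Let charN := pgroup_pchar_num C N.
Let ZN : ('Z(N) = N)%g := center_idP cNN.

Lemma card_Irr_abelian : #|Irr C N| = #|N|.
Proof.
by rewrite (card_irr_pchar _ charN splitN); apply/eqP; rewrite -card_classes_abelian.
Qed.

Lemma irr_mode_mul phi x y : x \in N -> y \in N ->
  irr phi (x * y)%g = irr phi x * irr phi y.
Proof. by move=> Nx Ny; apply: irr_modeM; rewrite ?ZN. Qed.

Lemma irr_mode_inv phi x : x \in N -> irr phi x^-1%g = (irr phi x)^-1.
Proof. by move=> Nx; apply: irr_modeV; rewrite ?ZN. Qed.

Lemma irr_mode_nz phi x : x \in N -> irr phi x != 0.
Proof. by move=> Nx; apply: irr_mode_neq0; rewrite ?ZN. Qed.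

(** All irreducible representations of N have degree 1, so equal scalars make them similar. *)
Lemma irr_mode_inj phi psi : {in N, irr phi =1 irr psi} -> phi = psi.
Proof.
move=> eq_irr; rewrite -(irr_reprK_pchar charN phi) -(irr_reprK_pchar charN psi).
apply: irr_comp_rsim_pchar => //.
have n1 := irr_degree_abelian splitN cNN.
have eqn : irr_degree phi = irr_degree psi by rewrite !n1.
exists (castmx (erefl, eqn) 1%:M) => //.
  by rewrite /row_free; case: _ / eqn; rewrite castmx_id mxrank1.
move=> x Nx; rewrite !irr_center_scalar ?ZN // eq_irr //.
by rewrite scalar_mxC.
Qed.

Lemma irr_mode_ortho phi psi : phi != psi ->
  \sum_(x in N) irr phi x * irr psi x^-1%g = 0.
Proof.
move=> nphi; have [x Nx nx] : exists2 x, x \in N & irr phi x != irr psi x.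
  apply/exists_inP; apply: contraR nphi => /exists_inPn ephi.
  by apply/eqP/irr_mode_inj => x /ephi; rewrite negbK => /eqP.
(* The substitution y -> x * y multiplies the sum by the ratio of the two values at x, which is not
   1. *)
set s := (X in X = 0); have sE : irr phi x * s = irr psi x * s.
  rewrite {2}/s (reindex_inj (mulgI x)) /= {1}/s !mulr_sumr.
  rewrite [RHS](eq_bigl [in N]) => [|y]; last by rewrite groupMl.
  apply: eq_bigr => y Ny; rewrite !irr_mode_inv ?groupM // !irr_mode_mul //.
  by field; rewrite !irr_mode_nz.
apply/eqP; move/eqP: sE; rewrite -subr_eq0 -mulrBl mulf_eq0 subr_eq0.
by rewrite (negPf nx).
Qed.

(** Both sides compute the trace of x in the regular representation. *)
Lemma sum_irr_mode x : x \in N ->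
  \sum_phi irr phi x = #|N|%:R *+ (x == 1%g).
Proof.
move=> Nx; have := mxtrace_regular_pchar (Irr C N) charN splitN Nx.
rewrite (eq_bigr (fun phi => irr phi x)) => [<-|phi _]; last first.
  rewrite (irr_degree_abelian splitN cNN) mulr1n.
  have -> := irr_center_scalar splitN phi (x := x); last by rewrite ZN.
  by rewrite mxtrace_scalar [X in _ *+ X](irr_degree_abelian splitN cNN).
rewrite /mxtrace (eq_bigr (fun _ => (x == 1%g)%:R)) => [|i _].
  by rewrite sumr_const card_ord; case: eqP => _ //; rewrite mul0rn.
rewrite !mxE; set y := enum_val i; have Ny : y \in N := enum_valP i.
rewrite -(inj_eq enum_val_inj) gring_indexK ?groupM //.
by rewrite eqxx /= -/y eq_sym -{2}[y]mulg1 (inj_eq (mulgI y)).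
Qed.

Section ChiIdem.
Variables (d : nat) (rG : mx_representation C G d).

Definition chi_idem (phi : Irr C N) : 'M[C]_d :=
  #|N|%:R^-1 *: \sum_(x in N) irr phi x^-1%g *: rG x.

Lemma cardN_neq0 : #|N|%:R != 0 :> C.
Proof. by rewrite pnatr_eq0 -lt0n cardG_gt0. Qed.

Lemma mul_chi_idem phi x : x \in N ->
  chi_idem phi *m rG x = irr phi x *: chi_idem phi.
Proof.
move=> Nx; rewrite -scalemxAl [RHS]scalerA mulrC -scalerA; congr (_ *: _).
rewrite mulmx_suml [in RHS](reindex_inj (mulIg x)) /= scaler_sumr.
rewrite [RHS](eq_bigl [in N]) => [|y]; last by rewrite groupMr.
apply: eq_bigr => y Ny; rewrite -scalemxAl -repr_mxM ?(subsetP sNG) // scalerA.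
rewrite invMg irr_mode_mul ?groupV // mulrA -irr_mode_mul ?groupV // mulgV.
by rewrite irr_mode1 mul1r.
Qed.

Lemma chi_idemP phi m (X : 'M[C]_(m, d)) :
  reflect (forall x, x \in N -> X *m rG x = irr phi x *: X)
          (X *m chi_idem phi == X).
Proof.
apply: (iffP eqP) => [<- x Nx|XN].
  by rewrite -mulmxA mul_chi_idem // -scalemxAr.
rewrite -scalemxAr mulmx_sumr (eq_bigr (fun _ => X)) => [|x Nx].
  by rewrite sumr_const -scaler_nat scalerA mulVf ?scale1r // cardN_neq0.
by rewrite -scalemxAr XN // scalerA -irr_mode_mul ?groupV // mulVg irr_mode1 scale1r.
Qed.

Lemma chi_idemM phi psi :
  chi_idem phi *m chi_idem psi = chi_idem phi *+ (phi == psi).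
Proof.
case: eqP => [<-|/eqP nphi]; first by apply/eqP/chi_idemP => x; apply: mul_chi_idem.
rewrite -scalemxAr mulmx_sumr.
rewrite (eq_bigr (fun x => (irr phi x * irr psi x^-1%g) *: chi_idem phi)).
  by rewrite -scaler_suml irr_mode_ortho // scale0r scaler0.
by move=> x Nx; rewrite -scalemxAr mul_chi_idem // scalerA mulrC.
Qed.

Lemma sum_chi_idem : \sum_phi chi_idem phi = 1%:M.
Proof.
rewrite -scaler_sumr exchange_big /= (bigD1 1%g) //= [X in _ + X]big1 => [|x /andP[Nx nx1]].
  rewrite addr0 -scaler_suml invg1 sum_irr_mode // eqxx scalerA mulVf ?cardN_neq0 //.
  by rewrite scale1r repr_mx1.
by rewrite -scaler_suml sum_irr_mode ?groupV // invg_eq1 (negPf nx1) scale0r.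
Qed.

Lemma joint_eigenspace_chi_idem phi :
  (joint_eigenspace rG N (irr phi) :=: chi_idem phi)%MS.
Proof.
apply/eqmxP/andP; split; last first.
  by apply/sub_bigcapmxP => x Nx; apply/eigenspaceP/mul_chi_idem.
set M := joint_eigenspace _ _ _; suff /eqP <- : M *m chi_idem phi == M.
  exact: submxMl.
by apply/chi_idemP => x Nx; apply/eigenspaceP; apply: bigcapmx_inf Nx _.
Qed.

End ChiIdem.

Lemma chi_idem_intertwine d n (rG : mx_representation C G d)
    (rH : mx_representation C G n) (phi : Irr C N) (X : 'M[C]_(d, n)) :
  (forall x, x \in N -> rG x *m X = X *m rH x) ->
  chi_idem rG phi *m X = X *m chi_idem rH phi.
Proof.
move=> XN; rewrite -scalemxAl -scalemxAr mulmx_suml mulmx_sumr.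
by congr (_ *: _); apply: eq_bigr => x Nx; rewrite -scalemxAl -scalemxAr XN.
Qed.

End LinearCharacters.

(** * Transfer between a quotient module and an invariant complement *)

Section Complement.
Variables (C : numClosedFieldType) (gT : finGroupType) (G N : {group gT}).
Hypotheses (cNN : abelian N) (sNG : N \subset G).
Variables (d t : nat) (rG : mx_representation C G d).
Variables (rT : mx_representation C G t) (Q : 'M[C]_d).
Variables (proj : 'M[C]_(d, t)) (sec : 'M[C]_(t, d)).
Hypotheses (sec_proj : sec *m proj = 1%:M) (proj_sec : proj *m sec = Q).
Hypothesis proj_hom : forall g, g \in G -> rG g *m proj = proj *m rT g.
Hypothesis sec_hom : forall g, g \in G -> rT g *m sec = sec *m rG g.

Local Notation epsG phi := (chi_idem (N := N) rG phi).
Local Notation epsT phi := (chi_idem (N := N) rT phi).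

Lemma sec_compl : sec *m Q = sec.
Proof. by rewrite -proj_sec mulmxA sec_proj mul1mx. Qed.

Lemma compl_chi_idem phi : epsT phi = sec *m (Q *m epsG phi) *m proj.
Proof.
rewrite mulmxA sec_compl -(chi_idem_intertwine (rG := rT)) => [|x Nx].
  by rewrite -mulmxA sec_proj mulmx1.
exact/sec_hom/(subsetP sNG).
Qed.

Lemma chi_idem_compl phi : Q *m epsG phi = proj *m epsT phi *m sec.
Proof.
rewrite -mulmxA (chi_idem_intertwine (rH := rG)) ?mulmxA ?proj_sec // => x Nx.
exact/sec_hom/(subsetP sNG).
Qed.

Hypothesis scalarQ : forall (X : 'M[C]_d) (phi : Irr C N), commutes rG X ->
  exists c, Q *m epsG phi *m X = c *: (Q *m epsG phi).

(** An endomorphism X of the quotient is carried to [proj *m X *m sec], an endomorphism of the whole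
    module to which [scalarQ] applies. *)
Lemma compl_scalar X phi : commutes rT X ->
  exists c, epsT phi *m X = c *: epsT phi.
Proof.
move=> cX; have [|c e] := scalarQ (X := proj *m X *m sec) phi.
  move=> g Gg; rewrite -[LHS]mulmxA -sec_hom // [LHS]mulmxA -[Z in Z *m sec = _]mulmxA cX //.
  by rewrite !mulmxA -proj_hom.
exists c; rewrite compl_chi_idem scalemxAl scalemxAr -e.
by rewrite -!mulmxA sec_proj mulmx1.
Qed.

Hypothesis nzQ : forall phi : Irr C N, Q *m epsG phi != 0.
Hypothesis cQ : forall phi : Irr C N, commutes rG (Q *m epsG phi).

Lemma compl_mult_free : mult_free_decomposition rT 1%:M
    (fun phi : Irr C N => joint_eigenspace rT N (irr_mode phi)).
Proof.
have EE phi psi : epsT phi *m epsT psi = epsT phi *+ (phi == psi).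
  exact: chi_idemM.
have cE phi : commutes rT (epsT phi).
  move=> g Gg; rewrite compl_chi_idem; move: (Q *m _) (cQ phi Gg) => K cK.
  by rewrite -[LHS]mulmxA -proj_hom // !mulmxA sec_hom // -(mulmxA sec) cK mulmxA.
have nzE phi : epsT phi != 0.
  by apply: contraNneq (nzQ phi) => e; rewrite chi_idem_compl e mulmx0 mul0mx.
have eqE phi : (joint_eigenspace rT N (irr_mode phi) :=: epsT phi)%MS.
  exact: joint_eigenspace_chi_idem.
have simE phi : mxsimple rT (epsT phi).
  have scE X psi (cX : commutes rT X) := compl_scalar psi cX.
  exact: (commutant_simple (pgroup_pchar_num C G) cE scE (nzE phi)).
have sumE := sumsmx_idem EE (erefl (\sum_phi epsT phi)).
rewrite (sum_chi_idem cNN) in sumE.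
have sumJ : (\sum_(phi : Irr C N) joint_eigenspace rT N (irr_mode phi) :=: 1%:M)%MS.
  by apply: eqmx_trans sumE; apply: eqmx_sums => phi _.
split=> [phi||| phi psi] //.
- exact: mx_iso_simple (eqmx_iso _ (eqmx_sym (eqE phi))) (simE phi).
- apply/mxdirectP; rewrite /= sumJ -sumE.
  have /mxdirectP /= -> := mxdirect_idem EE xpredT.
  by apply: eq_bigr => phi _; rewrite eqE.
move=> iso; apply: (commutant_iso EE cE _ (nzE phi)) => [X xi|].
  exact: compl_scalar.
apply: mx_iso_trans (mx_iso_trans iso _); last exact: eqmx_iso.
exact/eqmx_iso/eqmx_sym.
Qed.

(** A similarity of B with a submodule of the quotient lifts along [sec] to an endomorphism X with B
    X = X and X Q = X. As B X is a multiple of B and B Q = 0, X vanishes, which forces B = 0. *)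
Lemma compl_not_rsim (B : 'M[C]_d) (modB : mxmodule rG B) (M : 'M[C]_t)
    (modM : mxmodule rT M) :
    B *m B = B -> B != 0 -> commutes rG B -> B *m Q = 0 ->
    (forall X, commutes rG X -> exists c, B *m X = c *: B) ->
  ~ mx_rsim (submod_repr modB) (submod_repr modM).
Proof.
move=> BB B0 cB BQ scalarB [f _ freef homf].
(* The coordinate maps are replaced by their equivariance and injectivity, so that the dependent
   submodule representations can be generalized. *)
have [iB iBh iB_inj] : exists2 iB : 'M[C]_(d, \rank B),
    forall g, g \in G -> B *m rG g *m iB = B *m iB *m submod_repr modB g
  & B *m iB = 0 -> B = 0.
  exists (in_submod B 1%:M) => [g Gg|]; rewrite -!in_submodE.
    exact: in_submodJ (submx_refl B).
  by move=> e; rewrite -[LHS](in_submodK (submx_refl B)) e val_submodE mul0mx.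
have [vM vMh vM_free] : exists2 vM : 'M[C]_(\rank M, t),
    forall g, g \in G -> submod_repr modM g *m vM = vM *m rT g & row_free vM.
  exists (val_submod (U := M) 1%:M) => [g Gg|].
    by rewrite -val_submodE -val_submodJ // mul1mx.
  apply/row_freeP; exists (in_submod M 1%:M); rewrite -in_submodE.
  exact: val_submodK.
move: (submod_repr modB) (submod_repr modM) iBh vMh homf => rB rM iBh vMh homf.
pose X := B *m iB *m f *m vM *m sec.
have cX : commutes rG X.
  move=> g Gg; rewrite -[LHS]mulmxA -sec_hom // mulmxA -[Z in Z *m sec = _]mulmxA.
  rewrite -vMh // mulmxA -[Z in Z *m vM *m sec = _]mulmxA -homf // !mulmxA.
  by rewrite -iBh // -cB.
have XQ : X *m Q = X by rewrite -mulmxA sec_compl.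
have [c] := scalarB X cX; have -> : B *m X = X by rewrite !mulmxA BB.
move=> XcB; have X0 : X = 0 by rewrite -XQ XcB -scalemxAl BQ scaler0.
have : B *m iB *m f *m vM = 0.
  by rewrite -[LHS]mulmx1 -sec_proj mulmxA -/X X0 mul0mx.
move/eqP; rewrite mulmx_free_eq0 // mulmx_free_eq0 // => /eqP/iB_inj.
exact/eqP.
Qed.

End Complement.

Section FactorModule.
Variables (C : numClosedFieldType) (gT : finGroupType) (G : {group gT}).
Variables (d : nat) (rG : mx_representation C G d) (U P : 'M[C]_d).
Hypotheses (modU : mxmodule rG U) (PP : P *m P = P) (cP : commutes rG P).
Hypothesis PU : (P :=: U)%MS.
Local Notation Q := (1%:M - P).
Local Notation rT := (factmod_repr modU).

(** The linear section [val_factmod] need not be equivariant; following it by the equivariant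
    projector Q makes it so, because its image becomes an invariant complement of U. *)
Lemma factmod_section : exists proj sec, [/\ sec *m proj = 1%:M, proj *m sec = Q,
  forall g, g \in G -> rG g *m proj = proj *m rT g &
  forall g, g \in G -> rT g *m sec = sec *m rG g].
Proof.
have QQ : Q *m Q = Q by rewrite mulmxBl mul1mx !mulmxBr mulmx1 PP subrr subr0.
have cQ : commutes rG Q by move=> g Gg; rewrite mulmxBl mulmxBr mul1mx mulmx1 cP.
have [proj [v [P_proj v_proj e proj_hom]]] : exists proj v, [/\ P *m proj = 0,
    v *m proj = 1%:M, (1%:M - proj *m v <= P)%MS
  & forall g, g \in G -> rG g *m proj = proj *m rT g].
  exists (in_factmod U 1%:M), (val_factmod (U := U) 1%:M); split=> [|||g Gg].
  - by apply/eqP; rewrite -in_factmodE in_factmod_eq0 PU.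
  - by rewrite -in_factmodE; apply: val_factmodK.
  - rewrite PU -val_factmodE -{1}(add_sub_fact_mod U 1%:M) addrK.
    exact: val_submodP.
  - by rewrite -in_factmodE -[rG g]mul1mx in_factmodJ.
move: (factmod_repr modU) proj_hom => rH proj_hom.
have PQ0 : P *m Q = 0 by rewrite mulmxBr mulmx1 PP subrr.
have sec_proj : v *m Q *m proj = 1%:M.
  by rewrite -mulmxA mulmxBl mul1mx P_proj subr0.
have proj_sec : proj *m (v *m Q) = Q.
  have /submxP[D eD] := e; apply/eqP; rewrite eq_sym -subr_eq0 mulmxA.
  by rewrite -{1}[Q]mul1mx -mulmxBl eD -mulmxA PQ0 mulmx0.
exists proj, (v *m Q); split=> // g Gg.
transitivity (v *m Q *m (proj *m rH g) *m (v *m Q)).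
  by rewrite (mulmxA (v *m Q) proj) sec_proj mul1mx.
rewrite -proj_hom // !mulmxA -[_ *m v *m Q]mulmxA -[_ *m proj *m _]mulmxA proj_sec.
by rewrite -[_ *m rG g *m _]mulmxA -cQ // !mulmxA -[v *m Q *m Q]mulmxA QQ.
Qed.

End FactorModule.

(** * Schrodinger and Weil representations *)

Section AltForm.
Variables (R V : zmodType) (f : altForm R V).

Lemma alt0l v : f 0 v = 0.
Proof. by apply: (addrI (f 0 v)); rewrite -alt_addl !addr0. Qed.

Lemma alt0r v : f v 0 = 0.
Proof. by apply: (addrI (f v 0)); rewrite -alt_addr !addr0. Qed.

Lemma altNl u v : f (- u) v = - f u v.
Proof. by apply: (addrI (f u v)); rewrite -alt_addl !subrr alt0l. Qed.

Lemma altNr u v : f u (- v) = - f u v.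
Proof. by apply: (addrI (f u v)); rewrite -alt_addr !subrr alt0r. Qed.

Lemma altC u v : f u v = - f v u.
Proof.
apply/eqP; rewrite -addr_eq0; have := alt_diag f (u + v).
by rewrite alt_addl !alt_addr !alt_diag add0r addr0 => ->.
Qed.

Lemma altMnl u v n : f (u *+ n) v = f u v *+ n.
Proof. by elim: n => [|n IH]; rewrite ?alt0l // !mulrS alt_addl IH. Qed.

End AltForm.

Section Schrodinger.
Variables (C : numClosedFieldType) (R V : finZmodType) (f : altForm R V).
Variables (d : nat) (S : mx_representation C [set: heisenberg f] d).
Variable lambda : R -> C.
Hypothesis lambda0 : lambda 0 = 1.
Hypothesis lambdaD : forall a b, lambda (a + b) = lambda a * lambda b.
Hypothesis S_lambda : schrodinger S lambda.
Hypothesis nondeg : forall v, v != 0 -> exists u, lambda (f u v *+ 2) != 1.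

Local Notation T v := (S (heis f 0 v)).

Lemma repr_heis r v : S (heis f r v) = lambda r *: T v.
Proof.
have -> : heis f r v = (heis f r 0 * heis f 0 v)%g.
  by rewrite heisM alt0l !addr0 add0r.
by rewrite repr_mxM ?inE // (proj2 S_lambda) mul_scalar_mx.
Qed.

Lemma heis0 : T 0 = 1%:M. Proof. by rewrite (proj2 S_lambda) lambda0. Qed.

Lemma mul_heis u v : T u *m T v = lambda (f u v) *: T (u + v).
Proof. by rewrite -repr_mxM ?inE // heisM !add0r -repr_heis. Qed.

Lemma mul_heisC u v : T u *m T v = lambda (f u v *+ 2) *: (T v *m T u).
Proof.
rewrite !mul_heis addrC scalerA -lambdaD; congr (lambda _ *: _).
by rewrite [f v u]altC mulr2n addrK.
Qed.

Lemma mul_heisN u : T u *m T (- u) = 1%:M.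
Proof. by rewrite mul_heis altNr alt_diag oppr0 lambda0 scale1r subrr heis0. Qed.

Lemma mul_Nheis u : T (- u) *m T u = 1%:M.
Proof. by rewrite -{2}[u]opprK mul_heisN. Qed.

Lemma schrodinger_degree_gt0 : (0 < d)%N.
Proof. by case: S_lambda => /mx_irrP[]. Qed.

(** For nonzero v, conjugation by a suitable [T u] multiplies [T v] by a scalar other than 1. *)
Lemma mxtrace_heis v : \tr (T v) = d%:R *+ (v == 0).
Proof.
case: eqP => [->|/eqP/nondeg[u nz]]; first by rewrite heis0 mxtrace1.
have : \tr (T u *m T v *m T (- u)) = \tr (T v).
  by rewrite mxtrace_mulC mulmxA mul_Nheis mul1mx.
rewrite mul_heisC -scalemxAl -mulmxA mul_heisN mulmx1 mxtraceZ => /eqP.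
by rewrite -subr_eq0 -[X in _ - X]mul1r -mulrBl mulf_eq0 subr_eq0 (negPf nz) => /eqP.
Qed.

Lemma schrodinger_abs_irr : mx_absolutely_irreducible S.
Proof. by apply: group_closure_closed_field; case: S_lambda. Qed.

(** Absolute irreducibility makes the group algebra act onto all matrices, and the central elements
    contribute only scalars. *)
Lemma heis_span (X : 'M[C]_d) : exists c, X = \sum_v c v *: T v.
Proof.
have /andP[_ fullE] := schrodinger_abs_irr.
have /envelop_mxP[a ->] : (X \in enveloping_algebra_mx S)%MS.
  exact: submx_full.
exists (fun v => \sum_r a (heis f r v) * lambda r).
rewrite (eq_bigl predT) => [|x]; last by rewrite inE.
rewrite (eq_bigr (fun x : R * V => (a (heis f x.1 x.2) * lambda x.1) *: T x.2)).
  rewrite -(pair_bigA _ (fun r v => (a (heis f r v) * lambda r) *: T v)) /=.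
  by rewrite exchange_big; apply: eq_bigr => v _; rewrite scaler_suml.
by case=> r v _; rewrite (repr_heis r v : S (r, v) = _) scalerA.
Qed.

Lemma heis_scalar (X : 'M[C]_d) :
  (forall u, X *m T u = T u *m X) -> exists c, X = c%:M.
Proof.
move=> cX; apply/is_scalar_mxP/(mx_abs_irr_cent_scalar schrodinger_abs_irr).
apply/centgmxP => -[r u] _; rewrite (repr_heis r u : S (r, u) = _).
by rewrite -scalemxAl -scalemxAr cX.
Qed.

Lemma heis_sum_char v : \sum_u lambda (f u v) = #|V|%:R *+ (v == 0).
Proof.
case: eqP => [->|/eqP/nondeg[u nz]].
  by rewrite (eq_bigr (fun _ => 1)) ?sumr_const ?cardT // => u _; rewrite alt0r.
(* The shift is by [u *+ 2] because nondegeneracy concerns the doubled form, which is the commutator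
   pairing of the Heisenberg group. *)
have : \sum_w lambda (f w v) = lambda (f u v *+ 2) * \sum_w lambda (f w v).
  rewrite mulr_sumr [LHS](reindex_inj (addrI (u *+ 2))) /=.
  by apply: eq_bigr => w _; rewrite alt_addl altMnl lambdaD.
move/eqP; rewrite -subr_eq0 -[X in X - _]mul1r -mulrBl mulf_eq0 subr_eq0.
by rewrite eq_sym (negPf nz) => /eqP.
Qed.

Lemma degree_sqr_le : (d * d <= #|V|)%N.
Proof.
pose M := \matrix_(i < #|V|) mxvec (T (enum_val i)).
have <- : \rank M = (d * d)%N.
  apply/eqP; rewrite -[_ == _]sub1mx; apply/row_subP => i.
  have [c defX] := heis_span (vec_mx (row i 1%:M)).
  rewrite -[row i _]vec_mxK defX linear_sum summx_sub // => v _.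
  rewrite linearZ /= scalemx_sub // (eq_row_sub (enum_rank v)) //.
  by rewrite rowK enum_rankK.
exact: rank_leq_row.
Qed.

Section Average.
Variables (B : finZmodType) (theta : B -> V).
Hypothesis thetaD : forall a b, theta (a + b) = theta a + theta b.
Hypothesis theta_iso : forall a b, f (theta a) (theta b) = 0.

(** The projector onto the vectors fixed by an isotropic subgroup. The subgroup is given as the
    image of an additive map, so that sums can be reindexed over B even when the map has a
    kernel. *)
Definition heis_avg : 'M[C]_d := #|B|%:R^-1 *: \sum_b T (theta b).

Lemma card_zmod_neq0 : #|B|%:R != 0 :> C.
Proof. by rewrite pnatr_eq0 -lt0n; apply/card_gt0P; exists 0. Qed.

Lemma mul_heis_avg b : T (theta b) *m heis_avg = heis_avg.
Proof.
rewrite -scalemxAr; congr (_ *: _); rewrite mulmx_sumr.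
rewrite [RHS](reindex_inj (addrI b)) /=; apply: eq_bigr => a _.
by rewrite mul_heis theta_iso lambda0 scale1r thetaD.
Qed.

Lemma heis_avg_mul b : heis_avg *m T (theta b) = heis_avg.
Proof.
rewrite -scalemxAl; congr (_ *: _); rewrite mulmx_suml.
rewrite [RHS](reindex_inj (addIr b)) /=; apply: eq_bigr => a _.
by rewrite mul_heis theta_iso lambda0 scale1r thetaD.
Qed.

Lemma heis_avgP m (X : 'M[C]_(m, d)) :
  reflect (forall b, X *m T (theta b) = X) (X *m heis_avg == X).
Proof.
apply: (iffP eqP) => [<- b|XT]; first by rewrite -mulmxA heis_avg_mul.
rewrite -scalemxAr mulmx_sumr (eq_bigr (fun _ => X)) => [|b _]; last exact: XT.
by rewrite sumr_const -scaler_nat scalerA mulVf ?scale1r // card_zmod_neq0.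
Qed.

Lemma heis_avg_fixl n (X : 'M[C]_(d, n)) :
  (forall b, T (theta b) *m X = X) -> heis_avg *m X = X.
Proof.
move=> TX; rewrite -scalemxAl mulmx_suml (eq_bigr (fun _ => X)) => [|b _].
  by rewrite sumr_const -scaler_nat scalerA mulVf ?scale1r // card_zmod_neq0.
exact: TX.
Qed.

(** The trace is d / |B| times the number of b with theta b = 0, and b = 0 is one of them. *)
Lemma heis_avg_neq0 : heis_avg != 0.
Proof.
apply: contraTneq isT => /(congr1 mxtrace); rewrite mxtraceZ linear_sum /= linear0.
rewrite (eq_bigr (fun b => (d * (theta b == 0%R))%:R)) => [|b _]; last first.
  by rewrite mxtrace_heis; case: eqP; rewrite ?muln1 ?muln0.
rewrite -natr_sum => /eqP; rewrite mulf_eq0 invr_eq0 (negPf card_zmod_neq0) /=.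
rewrite pnatr_eq0 sum_nat_eq0 => /forallP/(_ 0) /=.
have -> : theta 0 = 0 by apply: (addrI (theta 0)); rewrite -thetaD !addr0.
by rewrite eqxx muln1 eqn0Ngt schrodinger_degree_gt0.
Qed.

Lemma heis_avg_comm (sigma : B -> B) (Y : 'M[C]_d) :
  injective sigma ->
  (forall b, T (theta b) *m Y = Y *m T (theta (sigma b))) ->
  heis_avg *m Y = Y *m heis_avg.
Proof.
move=> sigmaI YT; rewrite -scalemxAl -scalemxAr; congr (_ *: _).
rewrite mulmx_suml mulmx_sumr [in RHS](reindex_inj sigmaI) /=.
by apply: eq_bigr => b _.
Qed.

End Average.

Section Involution.

(* The operator implementing v |-> - v, up to the scalar |V|^(1/2). *)
Let E := \sum_v T v.
Let c : C := sqrtC #|V|%:R.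
Let P : 'M[C]_d := 2^-1 *: (1%:M + c^-1 *: E).

Let cardV_gt0 : 0 < #|V|%:R :> C.
Proof. by rewrite ltr0n; apply/card_gt0P; exists 0. Qed.

Let c_gt0 : 0 < c. Proof. by rewrite sqrtC_gt0 cardV_gt0. Qed.

(** Collecting the products [T u *m T v] by u + v leaves character sums over u, which vanish except
    at 0. *)
Let EE : E *m E = #|V|%:R%:M.
Proof.
rewrite mulmx_suml (eq_bigr (fun u => \sum_v lambda (f u v) *: T v)) => [|u _].
  rewrite exchange_big (bigD1 0) //= [X in _ + X]big1 => [|v v0].
    by rewrite addr0 -scaler_suml heis_sum_char eqxx heis0 scalemx1.
  by rewrite -scaler_suml heis_sum_char (negPf v0) scale0r.
rewrite mulmx_sumr [RHS](reindex_inj (addrI u)) /=; apply: eq_bigr => v _.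
by rewrite mul_heis alt_addr alt_diag add0r.
Qed.

Let PP : P *m P = P.
Proof.
have cE : c^-1 *: E *m (c^-1 *: E) = 1%:M.
  rewrite -scalemxAl -scalemxAr EE scalerA -invfM -expr2 sqrtCK.
  by rewrite scale_scalar_mx mulVf // lt0r_neq0.
rewrite /P -scalemxAl -scalemxAr scalerA mulmxDl !mulmxDr !mul1mx mulmx1 cE.
rewrite [X in _ + X]addrC -[X in X + X]scale1r -mulr2n -scaler_nat scalerA scalerA.
by rewrite mulr1 divfK // pnatr_eq0.
Qed.

(** P projects onto the eigenspace of E / c for the eigenvalue 1. Traces give d = c (r - r') for the
    two ranks r and r'; then d^2 = |V| (r - r')^2 and d^2 <= |V| force r - r' = 1. *)
Lemma parity_projector :
  exists P : 'M[C]_d, [/\ P *m P = P, \rank P = (\rank (1%:M - P)).+1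
    & forall (g : V -> V) (X : 'M[C]_d), injective g ->
        (forall u, T u *m X = X *m T (g u)) -> comm_mx P X].
Proof.
exists P; split=> //; last first.
  move=> g X gI XT; rewrite /comm_mx /P -scalemxAl -scalemxAr; congr (_ *: _).
  rewrite mulmxDl mulmxDr mul1mx mulmx1 -scalemxAl -scalemxAr; congr (_ + _ *: _).
  rewrite mulmx_suml mulmx_sumr [in RHS](reindex_inj gI) /=.
  by apply: eq_bigr => u _; apply: XT.
have QQ : (1%:M - P) *m (1%:M - P) = 1%:M - P.
  by rewrite mulmxBl mul1mx !mulmxBr mulmx1 PP subrr subr0.
have trE : \tr E = d%:R.
  rewrite linear_sum (bigD1 0) //= mxtrace_heis eqxx big1 ?addr0 // => v v0.
  by rewrite mxtrace_heis (negPf v0).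
have := mxtrace_idempotent QQ; have := mxtrace_idempotent PP.
rewrite linearB /= mxtrace1; set r := \rank _; set r' := \rank _ => trP.
rewrite trP => /eqP; rewrite subr_eq -natrD eqr_nat => /eqP defd.
move: trP; rewrite /P mxtraceZ mxtraceD mxtraceZ mxtrace1 trE => trP.
have rr' : d%:R = c * (r%:R - r'%:R).
  move: trP; rewrite defd natrD => trP; have c0 := lt0r_neq0 c_gt0.
  have : r%:R *+ 2 = r'%:R + r%:R + c^-1 * (r'%:R + r%:R) by rewrite -[X in X *+ 2]trP; field.
  by move=> e; have -> : r%:R - r'%:R = r%:R *+ 2 - (r'%:R + r%:R) :> C;
    [ring | rewrite e; field].
have lt_r : (r' < r)%N.
  rewrite -(ltr_nat C) -subr_gt0 -(pmulr_rgt0 _ c_gt0) -rr' ltr0n.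
  exact: schrodinger_degree_gt0.
have : (d * d = #|V| * ((r - r') * (r - r')))%N.
  apply/eqP; rewrite -(eqr_nat C) !natrM natrB ?(ltnW lt_r) // rr'.
  by rewrite mulrACA -expr2 sqrtCK.
move: degree_sqr_le lt_r; have : (0 < #|V|)%N by rewrite -(ltr0n C).
move: #|V| => m m_gt0 le_m lt_r eq_m.
have [|k2] := leqP (r - r') 1; first by lia.
have := leq_mul (leqnn m) (leq_mul k2 k2); rewrite -eq_m; lia.
Qed.

End Involution.

Section Intertwiners.
Variable g : V -> V.
Hypotheses (gI : injective g) (gD : forall u v, g (u + v) = g u + g v).
Hypothesis gf : forall u v, f (g u) (g v) = f u v.

Definition intertwines (X : 'M[C]_d) := forall u, T u *m X = X *m T (g u).

Lemma intertwiner_scalar X Y : X \in unitmx ->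
  intertwines X -> intertwines Y -> exists a, Y = a *: X.
Proof.
move=> uX XT YT; have [|a YX] := heis_scalar (X := Y *m invmx X).
  move=> u; rewrite [RHS]mulmxA YT -!mulmxA; congr (_ *m _).
  by apply: canRL (mulmxK uX) _; rewrite -mulmxA XT mulKmx.
by exists a; rewrite -(mulmxKV uX Y) YX mul_scalar_mx.
Qed.

(** Summing T (- v) M T (g v) over v always gives an intertwiner. For some elementary matrix M it is
    nonzero, and its kernel is then a proper submodule of an irreducible module, hence 0. *)
Lemma intertwiner_exists : exists2 X, X \in unitmx & intertwines X.
Proof.
pose X M := \sum_v T (- v) *m M *m T (g v).
have XT M : intertwines (X M).
  move=> u; rewrite mulmx_sumr mulmx_suml [LHS](reindex_inj (addrI u)) /=.
  apply: eq_bigr => v _; rewrite !mulmxA mul_heis -[RHS]mulmxA mul_heis gf.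
  rewrite -!scalemxAl -scalemxAr opprD addrA subrr add0r gD [g v + _]addrC.
  by rewrite alt_addr !altNr alt_diag oppr0 add0r [f v u]altC.
pose i0 := Ordinal schrodinger_degree_gt0.
have [k nzX] : exists k, X (delta_mx i0 k) != 0.
  apply/existsP; apply/contraT => /existsPn X0.
  (* Summing over k turns the second factor into the trace of [T (g v)], so only v = 0
     contributes. *)
  have : \sum_k (X (delta_mx i0 k)) i0 k = d%:R.
    rewrite (eq_bigr (fun k => \sum_v T (- v) i0 i0 * T (g v) k k)) => [|k _].
      rewrite exchange_big (bigD1 0) //= [X in _ + X]big1 => [|v v0].
        rewrite -mulr_sumr -/(\tr _) oppr0 (_ : g 0 = 0) ?heis0 ?mxtrace1 //.
          by rewrite mxE eqxx mul1r addr0.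
        by apply: (addrI (g 0)); rewrite -gD !addr0.
      rewrite -mulr_sumr -/(\tr _) mxtrace_heis (_ : g v == 0 = false) ?mulr0 //.
      apply: contraNF v0 => /eqP gv0; apply/eqP/gI; rewrite gv0.
      by apply: (addrI (g 0)); rewrite -gD !addr0.
    rewrite summxE; apply: eq_bigr => v _; rewrite -(mul_delta_mx (0 : 'I_1)).
    by rewrite mulmxA -colE -mulmxA -rowE mxE big_ord1 !mxE.
  rewrite big1 => [/esym/eqP|k _]; last first.
    by have := X0 k; rewrite negbK => /eqP ->; rewrite mxE.
  by rewrite pnatr_eq0 eqn0Ngt schrodinger_degree_gt0.
exists (X (delta_mx i0 k)) => //; apply: contraR nzX => nuX.
set Y := X _ in nuX *; have YT : intertwines Y by apply: XT.
have [/mx_irrP[_ irrS] _] := S_lambda.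
have : row_full (kermx Y).
  apply: irrS; last by rewrite kermx_eq0 row_free_unit.
  apply/mxmoduleP => -[r u] _; rewrite (repr_heis r u : S (r, u) = _).
  apply/sub_kermxP; rewrite -mulmxA -scalemxAl YT -scalemxAr mulmxA mulmx_ker.
  by rewrite mul0mx scaler0.
by rewrite -sub1mx => /sub_kermxP; rewrite mul1mx => ->.
Qed.

End Intertwiners.

Lemma weil_intertwines (G : {group {perm V}}) (W : mx_representation C G d) :
  weil S W <-> forall g, g \in G -> intertwines g (W g).
Proof.
split=> WT g Gg; [move=> u | move=> r u]; have uW := repr_mx_unit W Gg.
  by rewrite -(WT g Gg 0 u) !mulmxA mulmxV // mul1mx.
rewrite [S (heis f r u)]repr_heis [RHS]repr_heis -scalemxAr -scalemxAl.
by rewrite -mulmxA (WT g Gg) mulKmx.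
Qed.

(** The normalization singles out one intertwiner for each g, and products of normalized
    intertwiners are normalized, so the choice is multiplicative. *)
Lemma weil_exists (G : {group {perm V}}) :
    (forall g, g \in G -> forall u v, g (u + v) = g u + g v) ->
    (forall g, g \in G -> forall u v, f (g u) (g v) = f u v) ->
  exists W : mx_representation C G d, weil S W.
Proof.
move=> GD Gf; have [P [PP rP cP]] := parity_projector.
pose Q := 1%:M - P; have QQ : Q *m Q = Q.
  by rewrite mulmxBl mul1mx !mulmxBr mulmx1 PP subrr subr0.
have cPg g X : intertwines (fun v => (g : {perm V}) v) X -> comm_mx P X.
  by apply: cP; apply: perm_inj.
have cQg g X : intertwines (fun v => (g : {perm V}) v) X -> comm_mx Q X.
  by move/cPg => cPX; rewrite /comm_mx mulmxBl mulmxBr cPX mul1mx mulmx1.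
(* since \rank P = \rank Q + 1, exactly one multiple of an intertwiner
   satisfies the third condition *)
pose normal (g : {perm V}) X := [&& X \in unitmx,
  [forall u, T u *m X == X *m T (g u)] & det_on P X == det_on Q X].
have normalP (g : {perm V}) X : reflect [/\ X \in unitmx, intertwines g X
    & det_on P X = det_on Q X] (normal g X).
  apply: (iffP and3P) => -[uX XT /eqP eX]; split=> //.
    by move=> u; apply/eqP/(forallP XT).
  by apply/forallP => u; apply/eqP.
have ex (g : {perm V}) : exists X, (g \in G) ==> normal g X.
  have [Gg /=|] := boolP (g \in G); last by exists 0.
  have [X uX XT] := intertwiner_exists (@perm_inj _ g) (GD g Gg) (Gf g Gg).
  have cP1 := cPg g X XT; have cQ1 := cQg g X XT.
  have nzP := det_on_neq0 PP cP1 uX.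
  have nzQ := det_on_neq0 QQ cQ1 uX.
  (* Since [\rank P] exceeds [\rank Q] by one, scaling X by a multiplies the ratio of its
     determinants on P and Q by a. *)
  pose a := det_on Q X / det_on P X.
  have nza : a != 0 by rewrite mulf_neq0 ?invr_eq0.
  exists (a *: X); apply/normalP; split.
  - by rewrite unitmxZ ?unitfE.
  - by move=> u; rewrite -scalemxAr XT scalemxAl.
  rewrite !det_onZ // rP exprSr -mulrA; congr (_ * _).
  by rewrite divfK.
have uniq (g : {perm V}) X Y : normal g X -> normal g Y -> X = Y.
  move=> /normalP[uX XT eX] /normalP[uY YT eY].
  have [a defY] := intertwiner_scalar uX XT YT.
  have cP1 := cPg g X XT; have cQ1 := cQg g X XT.
  have nzP := det_on_neq0 PP cP1 uX.
  move: uY eY; rewrite defY !det_onZ // rP exprSr.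
  have [->|nza _] := eqVneq a 0.
    rewrite scale0r -row_free_unit /row_free mxrank0 eq_sym eqn0Ngt.
    by rewrite schrodinger_degree_gt0.
  rewrite -eX -mulrA => /(mulfI (expf_neq0 _ nza)).
  by rewrite -{2}[det_on P X]mul1r => /(mulIf nzP) ->; rewrite scale1r.
pose W (g : {perm V}) := xchoose (ex g).
have WP (g : {perm V}) : g \in G -> normal g (W g).
  by move: (xchooseP (ex g)) => /implyP.
have W_repr : mx_repr G W.
  split=> [|g k Gg Gk]; apply: uniq (WP _ _) _; rewrite ?group1 ?groupM //.
    apply/normalP; split; first exact: unitmx1.
      by move=> u; rewrite perm1 mulmx1 mul1mx.
    by rewrite /det_on !mulmx1 (addrC Q) (addrC P) !subrK.
  have /normalP[uX XT eX] := WP g Gg; have /normalP[uY YT eY] := WP k Gk.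
  apply/normalP; split; first by rewrite unitmx_mul uX.
    by move=> u; rewrite permM mulmxA XT -mulmxA YT mulmxA.
  have cP1 := cPg g _ XT; have cQ1 := cQg g _ XT.
  by rewrite !det_onM // eX eY.
exists (MxRepresentation W_repr); apply/weil_intertwines => g /WP.
by case/normalP.
Qed.

End Schrodinger.

(** * Ramified quadratic quotient rings *)

Section QuadraticQuotient.
Import Pdiv.CommonRing Pdiv.RingMonic.
Variables (O : idomainType) (s : O).
Local Notation h := ('X^2 - s%:P : {poly O}).
Local Notation t := ('qX : {poly %/ h}).
Local Notation c := (qpolyC h).

Lemma quad_size : size h = 3.
Proof. by rewrite size_XnsubC. Qed.

Lemma quad_monic : h \is monic. Proof. by rewrite monicXnsubC. Qed.

Lemma mk_monic_quad : mk_monic h = h.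
Proof. by rewrite /mk_monic quad_size quad_monic. Qed.

Lemma qpolyC_in a : c a = in_qpoly h a%:P.
Proof.
apply: val_inj => /=; rewrite rmodp_small // mk_monic_quad quad_size.
by rewrite (leq_ltn_trans (size_polyC_leq1 a)).
Qed.

Lemma qX_sqr : t * t = c s.
Proof.
have h0 : in_qpoly h h = 0.
  by apply: val_inj => /=; rewrite mk_monic_quad rmodpp // quad_monic.
by have := in_qpolyD h h s%:P; rewrite h0 add0r subrK expr2 in_qpolyM qpolyC_in.
Qed.

Lemma quad_dec z : exists a b, z = c a + c b * t.
Proof.
exists (val z)`_0, (val z)`_1; rewrite !qpolyC_in -in_qpolyM -in_qpolyD.
have sz : (size (val z) <= 2)%N.
  by rewrite -ltnS (leq_trans (size_mk_monic z)) // mk_monic_quad quad_size.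
have -> : ((val z)`_0)%:P + ((val z)`_1)%:P * 'X = val z.
  apply/polyP => -[|[|i]]; rewrite coefD coefC coefMX ?coefC /= ?addr0 ?add0r //.
  by rewrite nth_default // (leq_trans sz).
by apply: val_inj; rewrite /= rmodp_small // size_mk_monic.
Qed.

Lemma quad_eq0 a b : c a + c b * t = 0 -> a = 0 /\ b = 0.
Proof.
rewrite !qpolyC_in -in_qpolyM -in_qpolyD => /(congr1 val) /=.
rewrite rmodp_small => [e|].
  have {}e : a%:P + b%:P * 'X = 0 :> {poly O} by exact: e.
  move/polyP: e => e; split; [move: (e 0) | move: (e 1)].
    by rewrite coefD coefMX !coefC /= addr0.
  by rewrite coefD coefMX !coefC /= add0r.
rewrite mk_monic_quad quad_size (leq_ltn_trans (size_polyD _ _)) // gtn_max.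
rewrite (leq_ltn_trans (size_polyC_leq1 a)) //=.
by rewrite (leq_ltn_trans (size_polyMleq _ _)) // size_polyX addn2 /= !ltnS size_polyC_leq1.
Qed.

End QuadraticQuotient.

(** An interface that separates the arithmetic of A from its construction as a polynomial quotient.
    The odd exponent 2l-1 shows in [ram_pi]: multiplication by pi kills exactly p^(l-1) R. In
    [ram_sec], F indexes representatives of R / pR. *)
Record ramified (R A : finComNzRingType) (iota : {rmorphism R -> A})
    (star : {rmorphism A -> A}) (F : finType) (l : nat) (p : R) (pi : A) : Prop
    := Ramified {
  ram_l : (1 < l)%N;
  ram_sqr : pi * pi = iota p;
  ram_star : forall r, star (iota r) = iota r;
  ram_star_pi : star pi = - pi;
  ram_dec : forall a, exists r r', a = iota r + iota r' * pi;
  ram_inj : forall r, iota r = 0 -> r = 0;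
  ram_pi : forall r, iota r * pi = 0 <-> exists r', r = r' * p ^+ (l - 1);
  ram_pl : p ^+ l = 0;
  ram_val : forall i r r', (i < l)%N -> p ^+ i * r = p ^+ i.+1 * r' ->
    exists r'', r = p * r'';
  ram_unit : forall r, (exists r', r * r' = 1) \/ (exists r', r = p * r');
  ram_half : exists r : R, r *+ 2 = 1;
  ram_sec : exists sec : F -> R,
    (forall t t' r, sec t - sec t' = p * r -> t = t') /\
    (forall r, exists t r', r - sec t = p * r')
}.

Lemma unip_inv (B : comNzRingType) (x : B) k : x ^+ k = 0 ->
  exists y, (1 + x) * y = 1.
Proof.
move=> xk; exists (\sum_(i < k) (- x) ^+ i).
have := subrX1 (- x) k; rewrite exprNn xk mulr0 sub0r => /(congr1 -%R).
by rewrite opprK -mulNr opprB opprK => <-.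
Qed.

Section RamifiedQuotient.
Variables (O : idomainType) (s : O).
Hypotheses (O_local : local_with_maximal s)
  (O_not_field : exists2 x : O, x != 0 & x \isn't a GRing.unit).
Variables (F : finFieldType) (residue : {rmorphism O -> F}).
Hypotheses (residueP : is_quotient residue s) (F_odd : 2%N \notin [pchar F]).
Variables (l : nat) (l_gt1 : (1 < l)%N) (R A : finComNzRingType).
Variables (rhoR : {rmorphism O -> R}).
Hypothesis rhoRP : is_quotient rhoR (s ^+ l).
Variable rhoA : {rmorphism {poly %/ 'X^2 - s%:P} -> A}.
Hypothesis rhoAP : is_quotient rhoA ('qX ^+ (2 * l - 1)).
Variable iota : {rmorphism R -> A}.
Hypothesis iotaE : forall x : O, iota (rhoR x) = rhoA (qpolyC ('X^2 - s%:P) x).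
Variable star : {rmorphism A -> A}.
Hypothesis star_R : forall r : R, star (iota r) = iota r.
Hypothesis star_pi : star (rhoA 'qX) = - rhoA 'qX.
Local Notation p := (rhoR s).
Local Notation t := ('qX : {poly %/ 'X^2 - s%:P}).
Local Notation c := (qpolyC ('X^2 - s%:P)).

(** If s were 0, the zero ideal would be maximal, but a nonzero nonunit generates a larger proper
    ideal. *)
Lemma uniformizer_neq0 : s != 0.
Proof.
apply/eqP => s0; have [x x0 nux] := O_not_field.
have [_ _ maxI] : maximal_ideal (principal s) by apply/O_local.
pose J := principal x; have idJ : ideal J.
  split; first by exists 0; rewrite mul0r.
    by move=> _ _ [a ->] [b ->]; exists (a + b); rewrite mulrDl.
  by move=> a _ [b ->]; exists (a * b); rewrite mulrA.
have nJ1 : ~ J 1.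
  by case=> y e; case/negP: nux; apply/unitrPr; exists y; rewrite mulrC.
have JI z : principal s z -> J z.
  by case=> y ->; exists 0; rewrite s0 mulr0 mul0r.
have [|y xE] := maxI J idJ nJ1 JI x; first by exists 1; rewrite mul1r.
by move: x0; rewrite xE s0 mulr0 eqxx.
Qed.

Let residue_s : residue s = 0.
Proof. by apply/(proj2 residueP); exists 1; rewrite mul1r. Qed.

Let rhoR_eq0 x : rhoR x = 0 -> exists y, x = y * s ^+ l.
Proof. by move/(proj2 rhoRP). Qed.

Let p_l : p ^+ l = 0.
Proof. by rewrite -rmorphXn; apply/(proj2 rhoRP); exists 1; rewrite mul1r. Qed.

(** Multiplying by a lift of the inverse residue gives 1 plus a multiple of the nilpotent p,
    invertible by a geometric series. *)
Let unit_lift x : residue x != 0 -> exists r, rhoR x * r = 1.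
Proof.
move=> nz; have [y yE] := (proj1 residueP) (residue x)^-1.
have /(proj2 residueP)[z zE] : residue (x * y - 1) = 0.
  by rewrite rmorphB rmorphM yE mulfV // rmorph1 subrr.
have /unip_inv[w wE] : (rhoR z * p) ^+ l = 0 by rewrite exprMn p_l mulr0.
exists (rhoR y * w); rewrite mulrA -rmorphM -[x * y](subrK 1) zE addrC.
by rewrite rmorphD rmorph1 rmorphM.
Qed.

Let pow_odd k : t ^+ (k.*2.+1) = c (s ^+ k) * t.
Proof.
by rewrite [t ^+ _]exprSr -mul2n exprM [t ^+ 2]expr2 qX_sqr rmorphXn.
Qed.

(** The kernel is generated by t^(2l-1) = s^(l-1) t, and s^(l-1) t (a + b t) = s^l b + s^(l-1) a
    t. *)
Let rhoA_eq0 y : rhoA y = 0 <->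
  exists a b, y = c (s ^+ l * b) + c (s ^+ (l - 1) * a) * t.
Proof.
have -> : rhoA y = 0 <-> principal (t ^+ (2 * l - 1)) y := proj2 rhoAP y.
have -> : (2 * l - 1 = (l - 1).*2.+1)%N by lia.
have sl : s ^+ l = s * s ^+ (l - 1) by rewrite -exprS; congr (_ ^+ _); lia.
rewrite pow_odd; split=> [[z ->]|[a [b ->]]].
  have [a [b ->]] := quad_dec z; exists a, b.
  by rewrite sl !rmorphM /= -qX_sqr; ring.
by exists (c a + c b * t); rewrite sl !rmorphM /= -qX_sqr; ring.
Qed.

Lemma ramified_quotient : ramified iota star F l p (rhoA t).
Proof.
have surjR r : exists x, r = rhoR x by have [x <-] := proj1 rhoRP r; exists x.
split=> //.
- by rewrite -rmorphM qX_sqr iotaE.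
- move=> a; have [z <-] := proj1 rhoAP a; have [x [y ->]] := quad_dec z.
  by exists (rhoR x), (rhoR y); rewrite !iotaE rmorphD rmorphM.
- move=> r; have [x ->] := surjR r; rewrite iotaE => /rhoA_eq0[a [b e]].
  have [] := quad_eq0 (s := s) (a := x - s ^+ l * b) (b := - (s ^+ (l - 1) * a)).
    by rewrite rmorphB rmorphN mulNr /= e; ring.
  by move/eqP; rewrite subr_eq0 => /eqP -> _; rewrite rmorphM rmorphXn p_l mul0r.
- move=> r; have [x ->] := surjR r; split.
    rewrite iotaE -rmorphM => /rhoA_eq0[a [b e]].
    have [] := quad_eq0 (s := s) (a := - (s ^+ l * b)) (b := x - s ^+ (l - 1) * a).
      by rewrite rmorphB rmorphN mulrBl /= e; ring.
    move=> _ /eqP; rewrite subr_eq0 => /eqP ->; exists (rhoR a).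
    by rewrite rmorphM rmorphXn mulrC.
  case=> r' ->; have [a ->] := surjR r'; rewrite -rmorphXn -rmorphM iotaE -rmorphM.
  apply/rhoA_eq0; exists a, 0; rewrite mulr0 qpolyC0 add0r.
  by rewrite [a * _]mulrC.
- move=> i r r' il; have [x ->] := surjR r; have [y ->] := surjR r'.
  move/eqP; rewrite -subr_eq0 -!rmorphXn -!rmorphM -rmorphB => /eqP /rhoR_eq0[z e].
  (* As i < l, the multiple of s^l is absorbed into the term with s^(i+1); then s^i cancels in the
     domain O. *)
  have {}e : s ^+ i * (x - s * (y + z * s ^+ (l - i.+1))) = 0.
    transitivity (s ^+ i * x - s ^+ i.+1 * y - z * s ^+ l).
      rewrite [in RHS](_ : l = (i.+1 + (l - i.+1))%N); last by lia.
      by rewrite exprD !exprS; ring.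
    by rewrite e subrr.
  move/eqP: e; rewrite mulf_eq0 expf_eq0 (negPf uniformizer_neq0) andbF /=.
  rewrite subr_eq0 => /eqP ->; exists (rhoR (y + z * s ^+ (l - i.+1))).
  by rewrite rmorphM.
- move=> r; have [x ->] := surjR r; have [/(proj2 residueP)[y ->]|nz] := eqVneq (residue x) 0.
    by right; exists (rhoR y); rewrite rmorphM mulrC.
  by left; apply: unit_lift.
- have [|r rE] := unit_lift (x := 2%:R).
    by rewrite rmorph_nat; apply: contra F_odd => F2; rewrite inE.
  by exists r; rewrite -rE rmorph_nat mulr_natl.
have ex a : exists x, residue x == a by have [x <-] := proj1 residueP a; exists x.
have exK a : residue (xchoose (ex a)) = a by exact: eqP (xchooseP (ex a)).
exists (fun a => rhoR (xchoose (ex a))); split=> [a b r|r].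
  have [y ->] := surjR r; move/eqP; rewrite -subr_eq0 -rmorphM -!rmorphB.
  move=> /eqP /rhoR_eq0[z] /(congr1 residue).
  rewrite !(rmorphB, rmorphM, rmorphXn) !exK residue_s mul0r subr0.
  rewrite expr0n eqn0Ngt (ltnW l_gt1) mulr0 => /eqP.
  by rewrite subr_eq0 => /eqP.
have [x ->] := surjR r; exists (residue x).
have /(proj2 residueP)[y yE] : residue (x - xchoose (ex (residue x))) = 0.
  by rewrite rmorphB exK subrr.
by exists (rhoR y); rewrite -rmorphB yE rmorphM mulrC.
Qed.

End RamifiedQuotient.

(** * Valuation, skew elements and norm one elements of A *)

Section Ramified.
Variables (R A : finComNzRingType) (iota : {rmorphism R -> A}).
Variables (star : {rmorphism A -> A}) (F : finType) (l : nat) (p : R) (pi : A).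
Hypothesis ram : ramified iota star F l p pi.
Local Notation q := #|F|.

Let l1 : (1 < l)%N := ram_l ram.

Definition invertible (B : comNzRingType) (a : B) := exists b, a * b = 1.

Lemma uniformizer_not_unit r : p * r <> 1.
Proof.
move=> pr; have := oner_neq0 R; rewrite -(expr1n _ l) -pr exprMn (ram_pl ram).
by rewrite mul0r eqxx.
Qed.

Lemma pi_exp_even k : pi ^+ (2 * k) = iota (p ^+ k).
Proof. by rewrite exprM expr2 (ram_sqr ram) rmorphXn. Qed.

Lemma pi_exp_top : pi ^+ (2 * l - 2) = iota (p ^+ (l - 1)).
Proof. by rewrite -pi_exp_even; congr (_ ^+ _); lia. Qed.

Lemma p_exp_top_neq0 : p ^+ (l - 1) != 0.
Proof.
apply/eqP => p0; have [||r r1] := ram_val ram (i := l - 1) (r := 1) (r' := 0).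
- lia.
- by rewrite p0 mul0r mulr0.
- by case: (uniformizer_not_unit (r := r)).
Qed.

Lemma pi_exp_top_neq0 : pi ^+ (2 * l - 2) != 0.
Proof.
by rewrite pi_exp_top; apply: contra p_exp_top_neq0 => /eqP /(ram_inj ram) ->.
Qed.

Lemma pi_exp_eq0 k : (pi ^+ k == 0) = (2 * l - 1 <= k)%N.
Proof.
have piN : pi ^+ (2 * l - 1) = 0.
  have -> : (2 * l - 1 = (2 * l - 2).+1)%N by lia.
  by rewrite exprSr pi_exp_top; apply/(ram_pi ram); exists 1; rewrite mul1r.
apply/idP/idP => [|lk]; last by rewrite -(subnK lk) exprD piN mulr0.
apply: contraLR; rewrite -ltnNge => klt; apply: contra pi_exp_top_neq0 => /eqP pk.
by rewrite -(subnK (_ : k <= 2 * l - 2)%N) ?exprD ?pk ?mulr0 //; lia.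
Qed.

(** For a = r + r' pi with r a unit, the norm r^2 - p r'^2 is a unit, and the conjugate divided by
    the norm inverts a. If p divides r, then pi divides a. *)
Lemma ramified_local a : invertible a \/ exists b, a = pi * b.
Proof.
have [r [r' ->]] := ram_dec ram a.
have [[u ru]|[r1 ->]] := ram_unit ram r; last first.
  by right; exists (pi * iota r1 + iota r'); rewrite rmorphM -(ram_sqr ram); ring.
left; have [[v vE]|[w wE]] := ram_unit ram (r * r - p * r' * r').
  exists ((iota r - iota r' * pi) * iota v).
  by rewrite -(rmorph1 iota) -vE !(rmorphM, rmorphB) -(ram_sqr ram); ring.
case: (uniformizer_not_unit (r := u * u * (w + r' * r'))).
transitivity (u * u * (p * w + p * r' * r')); first by ring.
by rewrite -wE subrK mulrACA [u * r]mulrC ru mulr1.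
Qed.

Lemma pi_not_unit b : ~ invertible (pi * b).
Proof.
case=> c pbc; have := oner_neq0 A; rewrite -(expr1n _ (2 * l - 1)) -pbc !exprMn.
by rewrite (eqP (_ : pi ^+ _ == 0)) ?mul0r ?eqxx // pi_exp_eq0.
Qed.

Lemma unit_add_pi a b : invertible a -> invertible (a + pi * b).
Proof.
have [//|[c acE] [d ad]] := ramified_local (a + pi * b).
have aE : a = pi * (c - b) by rewrite mulrBr -acE addrK.
by case: (@pi_not_unit (c - b)); rewrite -aE; exists d.
Qed.

Lemma ramified_normal a :
  a = 0 \/ exists i u, [/\ (i < 2 * l - 1)%N, a = pi ^+ i * u & invertible u].
Proof.
suff: forall k, (exists b, a = pi ^+ k * b) \/
    exists i u, [/\ (i < k)%N, a = pi ^+ i * u & invertible u].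
  move/(_ (2 * l - 1)%N) => [[b ->]|]; last by right.
  by left; rewrite (eqP (_ : pi ^+ _ == 0)) ?mul0r // pi_exp_eq0.
elim=> [|k [[b ->]|[i [u [ik -> uu]]]]].
- by left; exists a; rewrite mul1r.
- have [ub|[c ->]] := ramified_local b; first by right; exists k, b.
  by left; exists c; rewrite exprSr mulrA.
- by right; exists i, u; split=> //; apply: leqW.
Qed.

(** Every nonzero ideal contains the minimal one: if a = pi^i u, multiply by pi^(2l-2-i) u^-1. *)
Lemma ramified_essential a : a != 0 -> exists b, a * b = pi ^+ (2 * l - 2).
Proof.
have [->|[i [u [il -> [v uv]]]] _] := ramified_normal a; first by rewrite eqxx.
exists (pi ^+ (2 * l - 2 - i) * v); rewrite mulrACA uv mulr1 -exprD.
by congr (_ ^+ _); lia.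
Qed.

Lemma pi_exp_ann k a : (k <= 2 * l - 1)%N -> pi ^+ k * a = 0 ->
  exists b, a = pi ^+ (2 * l - 1 - k) * b.
Proof.
move=> kl; have [->|[i [u [il -> [v uv]]]]] := ramified_normal a.
  by exists 0; rewrite mulr0.
move/(congr1 (fun x => x * v)); rewrite /= mul0r -!mulrA uv mulr1 -exprD.
move/eqP; rewrite pi_exp_eq0 => kil; exists (pi ^+ (i - (2 * l - 1 - k)) * u).
by rewrite mulrA -exprD; congr (_ ^+ _ * _); lia.
Qed.

Lemma starK : involutive star.
Proof.
move=> a; have [r [r' ->]] := ram_dec ram a.
by rewrite !(rmorphD, rmorphM, rmorphN, ram_star ram, ram_star_pi ram) opprK.
Qed.

Lemma star_pi_exp k : star (pi ^+ k) = (- 1) ^+ k * pi ^+ k.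
Proof. by rewrite rmorphXn (ram_star_pi ram) [LHS]exprNn. Qed.

Lemma half_exists : exists a : A, a *+ 2 = 1.
Proof.
by have [r rE] := ram_half ram; exists (iota r); rewrite -rmorphMn rE rmorph1.
Qed.

Lemma mulr2n_eq0W (a : A) : a *+ 2 = 0 -> a = 0.
Proof.
have [b b2] := half_exists => a2.
by rewrite -[a]mulr1 -b2 mulrnAr -mulrnAl a2 mul0r.
Qed.

Lemma double_inv : invertible (2%:R : A).
Proof. by have [b b2] := half_exists; exists b; rewrite mulr_natl. Qed.

Lemma skewP a : star a = - a <-> exists r, a = iota r * pi.
Proof.
split=> [|[r ->]]; last by rewrite rmorphM (ram_star ram) (ram_star_pi ram) mulrN.
have [r [r' ->]] := ram_dec ram a; move=> aS; exists r'; move: aS.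
rewrite rmorphD rmorphM !(ram_star ram) (ram_star_pi ram) mulrN => /eqP.
rewrite opprD (inj_eq (addIr _)) -addr_eq0 -mulr2n => /eqP/mulr2n_eq0W ->.
by rewrite add0r.
Qed.

Section Tower.
Variables (B : finZmodType) (m : nat -> R -> B) (k : nat).
Hypotheses (mB : forall i r r', m i (r - r') = m i r - m i r')
  (mp : forall i r, m i (p * r) = m i.+1 r)
  (m_ker : forall i r r', (i < k)%N -> m i r = m i.+1 r' ->
     exists r'', r = p * r'')
  (mk : forall r, m k r = 0).

(** The image of [m i] is the disjoint union of the translates by [m i (sec t)], for t in F, of the
    image of [m i.+1]. *)
Lemma card_tower i : (i <= k)%N -> #|[set m i r | r : R]| = (q ^ (k - i))%N.
Proof.
have [sec [sec_inj sec_surj]] := ram_sec ram.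
have m0 j : m j 0 = 0 by rewrite -(subrr 0) mB subrr.
have mD j a b : m j (a + b) = m j a + m j b.
  by rewrite -[b in LHS]opprK mB -sub0r mB m0 sub0r opprK.
move=> ik; rewrite -{1}(subKn ik); move: (k - i)%N (leq_subr i k) => {ik i}.
elim=> [|j IH] jk.
  rewrite subn0 expn0 (_ : [set _ | _ in _] = [set 0]) ?cards1 //.
  by apply/setP => y; rewrite inE; apply/imsetP/eqP => [[r _ ->]|->];
    [exact: mk | exists 0].
pose i := (k - j.+1)%N; have iS : (k - j)%N = i.+1 by rewrite /i; lia.
have ik : (i < k)%N by rewrite /i; lia.
rewrite -/i expnS -IH ?(ltnW jk) // iS -cardsT -cardsX.
rewrite -(card_in_imset (f := fun x => m i (sec x.1) + x.2)) => [|[t y] [t' y']].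
  apply: eq_card => y; apply/imsetP/imsetP => [[r _ ->]|[[t z]]].
    have [t [r' e]] := sec_surj r; exists (t, m i.+1 r') => /=.
      by rewrite !inE /= imset_f.
    by rewrite -mp -e mB addrC subrK.
  rewrite !inE /= => /imsetP[r _ ->] ->; exists (sec t + p * r) => //.
  by rewrite mD mp.
rewrite !inE /= => /imsetP[r _ ->] /imsetP[r' _ ->] e.
have [|r'' r''E] := m_ker (i := i) (r := sec t - sec t') (r' := r' - r) ik.
  by rewrite !mB; apply/eqP; rewrite subr_eq addrAC eq_sym subr_eq addrC e addrC.
have tt' := sec_inj _ _ _ r''E; rewrite tt' in e *.
by rewrite (addrI _ e).
Qed.

End Tower.

Lemma card_p_exp i : (i <= l)%N -> #|[set p ^+ i * r | r : R]| = (q ^ (l - i))%N.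
Proof.
apply: (card_tower (m := fun i r => p ^+ i * r)) => [j r r'|j r|j r r'|r].
- exact: mulrBr.
- by rewrite exprSr mulrA.
- exact: (ram_val ram).
- by rewrite (ram_pl ram) mul0r.
Qed.

(** Since p^(l-1) pi = 0, this tower is one step shorter than that of R. *)
Lemma card_p_exp_pi i : (i <= l - 1)%N ->
  #|[set iota (p ^+ i * r) * pi | r : R]| = (q ^ (l - 1 - i))%N.
Proof.
apply: (card_tower (m := fun i r => iota (p ^+ i * r) * pi)) => [j r r'|j r|j r r' jl|r].
- by rewrite -mulrBl -rmorphB mulrBr.
- by rewrite exprSr mulrA.
- move/eqP; rewrite -subr_eq0 -mulrBl -rmorphB => /eqP /(ram_pi ram)[x xE].
  apply: (ram_val ram (i := j) (r' := r' + p ^+ (l - 1 - j.+1) * x)); first lia.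
  rewrite mulrDr mulrA -exprD (_ : j.+1 + (l - 1 - j.+1) = l - 1)%N; last lia.
  by rewrite [_ * x]mulrC -xE addrC subrK.
- by apply/(ram_pi ram); exists r; rewrite mulrC.
Qed.

(** The set is p^i R pi for j = 2i and p^(i+1) R for j = 2i+1; both have q^(l-1-i) elements. *)
Lemma card_pi_skew j : (j < 2 * l - 1)%N ->
  #|[set pi ^+ j * (iota r * pi) | r : R]| = (q ^ (l - 1 - j./2))%N.
Proof.
move=> jl; rewrite -[in pi ^+ j](odd_double_half j) -mul2n addnC exprD pi_exp_even.
have := jl; rewrite -{1}(odd_double_half j) -mul2n.
case: (odd j) => /= jl2; last first.
  rewrite -card_p_exp_pi; last by lia.
  congr #|pred_of_set _|; apply: eq_imset => r.
  by rewrite rmorphM expr0 mulr1 mulrA.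
rewrite (_ : l - 1 - j./2 = l - (j./2).+1)%N; last by lia.
have iI : injective iota.
  by move=> x y /eqP; rewrite -subr_eq0 -rmorphB => /eqP/(ram_inj ram)/eqP;
    rewrite subr_eq0 => /eqP.
rewrite -card_p_exp; last by lia.
rewrite -(card_imset _ iI).
rewrite -imset_comp; congr #|pred_of_set _|; apply: eq_imset => r.
by rewrite /= [p ^+ _.+1]exprSr !rmorphM -(ram_sqr ram); ring.
Qed.

Definition ring_inv (a : A) : A := odflt 0 [pick b | a * b == 1].

Lemma mulr_ring_inv a : invertible a -> a * ring_inv a = 1.
Proof.
move=> [b ab]; rewrite /ring_inv; case: pickP => [c /eqP //|/(_ b)].
by rewrite ab eqxx.
Qed.

Lemma invertible_lreg (a x y : A) : invertible a -> a * x = a * y -> x = y.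
Proof.
move=> [b ab] e; rewrite -[x]mul1r -[y]mul1r -ab.
by rewrite -!mulrA (mulrCA a b x) (mulrCA a b y) e.
Qed.

(* The Cayley transform, a bijection from the skew elements onto the norm one
   elements congruent to 1 modulo pi. *)
Definition cayley (x : A) : A := (1 - x) * ring_inv (1 + x).

Lemma cayleyE x : invertible (1 + x) -> cayley x * (1 + x) = 1 - x.
Proof. by move=> ux; rewrite mulrAC -mulrA mulr_ring_inv // mulr1. Qed.

Lemma unit_add_skew r e : invertible (1 + iota r * pi * e).
Proof.
rewrite [iota r * pi]mulrC -mulrA; apply: unit_add_pi.
by exists 1; rewrite mulr1.
Qed.

Lemma unit_1D_skew r : invertible (1 + iota r * pi).
Proof. by have := unit_add_skew r 1; rewrite mulr1. Qed.

Lemma cayley_norm_one r : cayley (iota r * pi) \in norm_one star.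
Proof.
set x := iota r * pi; have xS : star x = - x by apply/skewP; exists r.
have ux : invertible (1 + x) := unit_1D_skew r.
have /(congr1 star) := mulr_ring_inv ux.
rewrite rmorphM rmorphD rmorph1 xS inE /cayley rmorphM rmorphB rmorph1 xS opprK.
move: (star (ring_inv _)) (mulr_ring_inv ux) => y xy e.
apply/eqP; transitivity ((1 + x) * ring_inv (1 + x) * ((1 - x) * y)); first by ring.
by rewrite xy e mulr1.
Qed.

(** Up to sign a is some b1 congruent to 1 modulo pi. Then 1 + b1 is a unit, x = (1 - b1) / (1 + b1)
    is skew, and the Cayley transform, being its own inverse, sends x to b1. *)
Lemma norm_one_cayley a : a \in norm_one star ->
  exists r e, a = (-1) ^+ (e : bool) * cayley (iota r * pi).
Proof.
rewrite inE => /eqP aa.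
have [e [b be]] : exists (e : bool) b, (-1) ^+ e * a = 1 + pi * b.
  have [r [r' defa]] := ram_dec ram a; move: aa.
  rewrite defa rmorphD rmorphM !(ram_star ram) (ram_star_pi ram) => aa.
  (* The norm equation reads (r - 1)(r + 1) = p r'^2. The two factors cannot both be units, so r is
     1 or -1 modulo p. *)
  have /(ram_inj ram) rr : iota ((r - 1) * (r + 1) - p * (r' * r')) = 0.
    have : iota r * iota r - pi * pi * iota r' * iota r' - 1 = 0.
      by apply/eqP; rewrite subr_eq0 -{1}aa; apply/eqP; ring.
    by move=> <-; rewrite !(rmorphB, rmorphM, rmorphD, rmorph1) -(ram_sqr ram); ring.
  have pD x y : r = x + p * y -> iota r + iota r' * pi = iota x + pi * (pi * iota y + iota r').
    by move=> ->; rewrite rmorphD rmorphM -(ram_sqr ram); ring.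
  have [[u uE]|[x xE]] := ram_unit ram (r - 1); last first.
    exists false, (pi * iota x + iota r'); rewrite mul1r (pD 1 x) ?rmorph1 //.
    by rewrite -xE addrC subrK.
  have [[v vE]|[y yE]] := ram_unit ram (r + 1).
    case: (@uniformizer_not_unit (r' * r' * u * v)).
    transitivity (((r - 1) * u) * ((r + 1) * v) -
      ((r - 1) * (r + 1) - p * (r' * r')) * u * v); first by ring.
    by rewrite uE vE rr mul1r !mul0r subr0.
  exists true, (- (pi * iota y + iota r')); rewrite expr1 (pD (- 1) y) ?rmorphN1.
    by ring.
  by rewrite -yE addrC addrK.
have [b1 [aE b1E b1S]] : exists b1, [/\ a = (-1) ^+ e * b1, b1 = 1 + pi * b
    & star b1 * b1 = 1].
  exists ((-1) ^+ e * a); split=> //; first by rewrite mulrA -expr2 sqrr_sign mul1r.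
  rewrite rmorphM rmorph_sign mulrACA -expr2 sqrr_sign mul1r mulrC.
  exact: aa.
have u1 : invertible (1 + b1).
  by rewrite b1E addrA; apply: unit_add_pi; rewrite -mulr2n; apply: double_inv.
pose x := (1 - b1) * ring_inv (1 + b1).
have xS : star x = - x.
  have ub : invertible b1 by exists (star b1); rewrite mulrC.
  apply: (invertible_lreg u1); apply: (invertible_lreg (_ : invertible (star b1))).
    by exists b1.
  have e1 := mulr_ring_inv u1; have := congr1 star e1; rewrite /x.
  rewrite !(rmorphM, rmorphD, rmorphB, rmorph1).
  move: (ring_inv _) (star (ring_inv _)) e1 => w z ew ez.
  transitivity ((star b1 + star b1 * b1) * z * (1 - star b1)); first by ring.
  rewrite b1S [_ + 1]addrC ez mul1r.
  transitivity (- ((star b1 - star b1 * b1) * ((1 + b1) * w))); last by ring.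
  by rewrite ew b1S mulr1 opprB.
have /skewP[r xE] := xS; exists r, e.
rewrite aE -xE; congr (_ * _).
have ux : invertible (1 + x) by rewrite xE; apply: unit_1D_skew.
apply: (invertible_lreg ux); rewrite mulrC [RHS]mulrC cayleyE //.
have : x * (1 + b1) = 1 - b1 by rewrite mulrAC -mulrA mulr_ring_inv // mulr1.
move=> e1; transitivity (x * (1 + b1) + b1 - x); first by ring.
by rewrite e1; ring.
Qed.

Lemma norm_one_sign e a : a \in norm_one star ->
  (-1) ^+ (e : bool) * a \in norm_one star.
Proof.
by rewrite !inE rmorphM rmorph_sign mulrACA -expr2 sqrr_sign mul1r.
Qed.

(** The elements used are signs times Cayley transforms of skew x, one x for each value of P x. A
    coincidence gives 2 P (x - x') = 0 for equal signs and 2 P (1 - x x') = 0 for opposite ones; the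
    latter is impossible as 1 - x x' is a unit. *)
Lemma leq_card_norm_one i : (i < l)%N ->
  (2 * q ^ (l - 1 - i) <= #|[set (a * pi ^+ (2 * i))%R | a in norm_one star]|)%N.
Proof.
move=> il; set P := pi ^+ (2 * i).
have il2 : (2 * i < 2 * l - 1)%N by lia.
have nzP : P != 0 by rewrite pi_exp_eq0 -ltnNge.
pose S := [set P * (iota r * pi) | r : R].
have cS : #|S| = (q ^ (l - 1 - i))%N.
  by rewrite card_pi_skew // mul2n doubleK.
pose k y := iota (odflt 0 [pick r | P * (iota r * pi) == y]) * pi.
have kE y : y \in S -> P * k y = y.
  case/imsetP => r _ yE; rewrite /k; case: pickP => [r' /eqP //|/(_ r)].
  by rewrite yE eqxx.
pose g (x : bool * A) := (-1) ^+ x.1 * cayley (k x.2) * P.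
rewrite -cS -card_bool -cardsT -cardsX -(card_in_imset (f := g)).
  apply/subset_leq_card/subsetP => _ /imsetP[[e y] _ ->].
  by apply/imset_f/norm_one_sign/cayley_norm_one.
move=> [e y] [e' y']; rewrite !inE /= => Sy Sy'; rewrite /g /= => eqg.
have := kE y Sy; have := kE y' Sy'; move: eqg; rewrite /k.
move: (odflt 0 _) (odflt 0 _) => r' r; set x := _ * pi; set x' := _ * pi => eqg.
have ux : invertible (1 + x) := unit_1D_skew r.
have ux' : invertible (1 + x') := unit_1D_skew r'.
have {}eqg : (-1) ^+ e * (1 - x) * (1 + x') * P = (-1) ^+ e' * (1 - x') * (1 + x) * P.
  rewrite -(cayleyE ux) -(cayleyE ux').
  transitivity ((-1) ^+ e * cayley x * P * (1 + x) * (1 + x')); first by ring.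
  by rewrite eqg; ring.
have [ee'|ne] := eqVneq e e'.
  move=> y'E yE; rewrite ee' -y'E -yE; congr (_, _).
  apply/eqP; rewrite -subr_eq0; apply/eqP/mulr2n_eq0W.
  apply: (invertible_lreg (_ : invertible ((-1) ^+ e))).
    by exists ((-1) ^+ e); rewrite -expr2 sqrr_sign.
  rewrite mulr0.
  transitivity ((-1) ^+ e * (1 - x') * (1 + x) * P - (-1) ^+ e * (1 - x) * (1 + x') * P).
    by ring.
  by rewrite eqg ee' subrr.
have P0 : P * (1 - x * x') *+ 2 = 0.
  move: eqg; have -> : e' = ~~ e by case: (e) (e') ne => [] [].
  rewrite signrN => eqg; apply: (invertible_lreg (_ : invertible ((-1) ^+ e))).
    by exists ((-1) ^+ e); rewrite -expr2 sqrr_sign.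
  transitivity ((-1) ^+ e * (1 - x) * (1 + x') * P - - (-1) ^+ e * (1 - x') * (1 + x) * P).
    by ring.
  by rewrite eqg; ring.
have ux'' : invertible (1 - x * x').
  rewrite -mulrN -[iota r * pi * _]/(_ * _) /x; exact: unit_add_skew.
case/eqP: nzP; apply: (invertible_lreg ux''); rewrite mulr0 mulrC.
exact: mulr2n_eq0W.
Qed.

Lemma card_norm_one : #|norm_one star| = (2 * q ^ (l - 1))%N.
Proof.
have cK : #|[set iota r * pi | r : R]| = (q ^ (l - 1))%N.
  rewrite -[in RHS](subn0 (l - 1)%N) -card_p_exp_pi //.
  by congr #|pred_of_set _|; apply: eq_imset => r; rewrite mul1r.
apply/eqP; rewrite eqn_leq; apply/andP; split.
  rewrite -card_bool -cK -cardsT -cardsX.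
  pose g (x : bool * A) := (-1) ^+ x.1 * cayley x.2.
  apply: leq_trans (leq_imset_card g _).
  apply/subset_leq_card/subsetP => a /norm_one_cayley[r [e ->]].
  by apply/imsetP; exists (e, iota r * pi); rewrite // !inE /=; apply/imsetP; exists r.
have := leq_card_norm_one (ltnW l1); rewrite subn0 => /leq_trans; apply.
exact: leq_imset_card.
Qed.

End Ramified.

(** * Skew hermitian forms *)

Section SkewHermitian.
Variables (R A : finComNzRingType) (iota : {rmorphism R -> A}).
Variables (star : {rmorphism A -> A}) (F : finType) (l : nat) (p : R) (pi : A).
Hypothesis ram : ramified iota star F l p pi.
Variables (m : nat) (h : 'rV[A]_m -> 'rV[A]_m -> A).
Hypotheses (h_skew : skew_hermitian h star) (h_nondeg : nondegenerate_form h).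
Local Notation V := 'rV[A]_m.

Lemma sformDr u v w : h u (v + w) = h u v + h u w.
Proof. by case: h_skew => hl _ _; have := hl u 1 v w; rewrite scale1r mul1r. Qed.

Lemma sformDl u v w : h (u + v) w = h u w + h v w.
Proof.
case: h_skew => _ hl _; have := hl w 1 u v.
by rewrite scale1r /= rmorph1 mul1r.
Qed.

Lemma sform0r u : h u 0 = 0.
Proof. by apply: (addrI (h u 0)); rewrite -sformDr !addr0. Qed.

Lemma sform0l u : h 0 u = 0.
Proof. by apply: (addrI (h 0 u)); rewrite -sformDl !addr0. Qed.

Lemma sformZr a u v : h u (a *: v) = a * h u v.
Proof.
by case: h_skew => hl _ _; have := hl u a v 0; rewrite sform0r !addr0.
Qed.

Lemma sformZl a u v : h (a *: u) v = star a * h u v.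
Proof.
by case: h_skew => _ hl _; have := hl v a u 0; rewrite sform0l !addr0.
Qed.

Lemma sformC u v : h v u = - star (h u v).
Proof. by case: h_skew. Qed.

Lemma star_form u v : star (h u v) = - h v u.
Proof. by rewrite (sformC u v) opprK. Qed.

Lemma form_diag u : star (h u u) = - h u u. Proof. exact: star_form. Qed.

Lemma form_neq0 v : v != 0 -> exists w, h v w != 0.
Proof.
move=> v0; apply/existsP; apply: contraR v0 => /existsPn hv0.
apply/eqP/h_nondeg => w; rewrite sform0l; apply/eqP.
by have := hv0 w; rewrite negbK.
Qed.

Lemma invertible_star a : invertible a -> invertible (star a).
Proof. by move=> [b ab]; exists (star b); rewrite -rmorphM ab rmorph1. Qed.

Lemma invertible_opp (a : A) : invertible a -> invertible (- a).
Proof. by move=> [b ab]; exists (- b); rewrite mulrNN. Qed.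

Lemma invertible_formC u v : invertible (h u v) -> invertible (h v u).
Proof. by rewrite (sformC u v) => /invertible_star/invertible_opp. Qed.

Lemma vec_ann k (v : V) : (k <= 2 * l - 1)%N -> pi ^+ k *: v = 0 ->
  exists w, v = pi ^+ (2 * l - 1 - k) *: w.
Proof.
move=> kl v0; have /fin_all_exists[w wE] (j : 'I_m) :
    exists b, v 0 j = pi ^+ (2 * l - 1 - k) * b.
  apply: (pi_exp_ann ram kl); have := congr1 (fun x : V => x 0 j) v0.
  by rewrite !mxE.
by exists (\row_j w j); apply/rowP => j; rewrite !mxE wE.
Qed.

Definition primitive (v : V) := [forall w, v != pi *: w].

Lemma primitiveP v : primitive v \/ exists w, v = pi *: w.
Proof.
have [|] := boolP (primitive v); first by left.
by rewrite negb_forall => /existsP[w]; rewrite negbK => /eqP; right; exists w.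
Qed.

Lemma form_primitive v w : invertible (h v w) -> primitive v.
Proof.
move=> u; apply/forallP => x; apply/eqP => vE; move: u.
by rewrite vE sformZl (ram_star_pi ram) mulNr -mulrN; apply: (pi_not_unit ram).
Qed.

(** The vector pi^(2l-2) v is nonzero, so it pairs nontrivially with some w; were h(v, w) divisible
    by pi, that pairing would be a multiple of pi^(2l-1) = 0. *)
Lemma primitive_form v : primitive v -> exists w, invertible (h v w).
Proof.
move=> /forallP pv; have : pi ^+ (2 * l - 2) *: v != 0.
  apply/eqP => /vec_ann[|w]; first by have := ram_l ram; lia.
  have := ram_l ram => l1; rewrite (_ : 2 * l - 1 - _ = 1)%N; last by lia.
  by move=> /eqP; rewrite expr1 (negPf (pv w)).
case/form_neq0 => w nz; exists w.
have [//|[b bE]] := ramified_local ram (h v w).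
move: nz; rewrite sformZl bE (star_pi_exp ram) -mulrA (mulrA (pi ^+ _)) -exprSr.
rewrite (eqP (_ : pi ^+ _ == 0)) ?mul0r ?mulr0 ?eqxx // (pi_exp_eq0 ram).
by have := ram_l ram; lia.
Qed.

Lemma vec_normal v :
  v = 0 \/ exists k w, [/\ (k < 2 * l - 1)%N, v = pi ^+ k *: w & primitive w].
Proof.
suff: forall k, (exists w, v = pi ^+ k *: w) \/
    exists i w, [/\ (i < k)%N, v = pi ^+ i *: w & primitive w].
  move/(_ (2 * l - 1)%N) => [[b ->]|]; last by right.
  by left; rewrite (eqP (_ : pi ^+ _ == 0)) ?scale0r // (pi_exp_eq0 ram).
elim=> [|k [[w ->]|[i [u [ik -> uu]]]]].
- by left; exists v; rewrite scale1r.
- have [ub|[c ->]] := primitiveP w; first by right; exists k, w.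
  by left; exists c; rewrite scalerA exprSr.
- by right; exists i, u; split=> //; apply: leqW.
Qed.

Definition isometry_fun (g : V -> V) :=
  (forall a u v, g (a *: u + v) = a *: g u + g v) /\
  (forall u v, h (g u) (g v) = h u v).

Lemma isometry_unitary g : isometry_fun g ->
  exists2 s, s \in unitary h & forall v, s v = g v.
Proof.
move=> [gL gh]; have gI : injective g.
  move=> x y gxy; apply: h_nondeg => z.
  by rewrite -gh gxy gh.
exists (perm gI) => [|v]; last by rewrite permE.
by apply/unitaryP; split=> *; rewrite !permE ?gL ?gh.
Qed.

(** The map x -> x + c h(u, x) u with u = w - v and c = h(u, v)^-1. Here h(u, v) = h(w, v) - h(v, v)
    is a unit because the skew h(v, v) is divisible by pi. *)
Lemma reflection_exists v w : h v v = h w w -> invertible (h v w) ->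
  exists2 g, g \in unitary h & g v = w.
Proof.
move=> vw u_vw; have [u wE] : exists u, w = v + u.
  by exists (w - v); rewrite addrC subrK.
have hww : h w w = h v v + h v u + h u v + h u u.
  by rewrite {1 2}wE sformDr !sformDl; ring.
have [c dc] : invertible (h u v).
  rewrite -[h u v](addKr (h v v)) -sformDl -wE addrC.
  have /(skewP ram)[r ->] := form_diag v.
  rewrite [_ * pi]mulrC -mulrN; apply: (unit_add_pi ram).
  exact: invertible_formC.
(* This is the factor that must vanish for the map to be an isometry; it is the equality of the
   lengths of v and w, multiplied by c and its conjugate. *)
have cE : - c + star c + star c * c * h u u = 0.
  have sdc : star (h u v) * star c = 1 by rewrite -rmorphM dc rmorph1.
  have hu : h u v - star (h u v) + h u u = 0.
    rewrite star_form opprK; apply: (addrI (h v v)).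
    by rewrite addr0 {2}vw hww; ring.
  transitivity (c * star c * (h u v - star (h u v) + h u u) +
    c * (star (h u v) * star c - 1) - star c * (h u v * c - 1)); first by ring.
  by rewrite hu dc sdc !(subrr, mulr0, addr0, oppr0).
have [|g Ug gE] := isometry_unitary (g := fun x => x + (c * h u x) *: u).
  split=> [a x y|x y].
    rewrite sformDr sformZr mulrDr scalerDl scalerDr scalerA addrACA.
    by rewrite mulrCA.
  rewrite sformDl !sformDr !sformZl !sformZr rmorphM star_form.
  transitivity (h x y - h x u * h u y * (- c + star c + star c * c * h u u)).
    by ring.
  by rewrite cE mulr0 subr0.
by exists g => //; rewrite gE mulrC dc scale1r -wE.
Qed.

(* On the finite set of skew elements, kappa |-> 2 kappa - kappa^2 beta is
   injective, hence onto. *)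
Lemma skew_quadratic b t : star b = - b -> star t = - t ->
  exists r, let k := iota r * pi in k *+ 2 - k * k * b = t.
Proof.
move=> bS tS; pose K := [set k : A | star k == - k].
pose phi k := k *+ 2 - k * k * b.
have phiK : phi @: K = K.
  apply/eqP; rewrite eqEcard; apply/andP; split.
    apply/subsetP => _ /imsetP[k kK ->]; move: kK; rewrite !inE => /eqP kS.
    by apply/eqP; rewrite /phi rmorphB rmorphMn !rmorphM bS kS; ring.
  rewrite card_in_imset // => k k'; rewrite !inE.
  move=> /eqP/(skewP ram)[r ->] /eqP/(skewP ram)[r' ->]; rewrite /phi.
  set x := _ * pi; set x' := _ * pi => e.
  have u : invertible (2 - (x + x') * b).
    rewrite (_ : _ - _ = 2 + pi * (- (iota r + iota r') * b)).
      by apply: (unit_add_pi ram); apply: (double_inv ram).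
    by rewrite /x /x'; ring.
  apply/eqP; rewrite -subr_eq0; apply/eqP; apply: (invertible_lreg u).
  rewrite mulr0; transitivity (x *+ 2 - x * x * b - (x' *+ 2 - x' * x' * b)).
    by ring.
  by rewrite e subrr.
have : t \in phi @: K by rewrite phiK inE tS.
case/imsetP => k; rewrite inE => /eqP/(skewP ram)[r ->] ->.
by exists r.
Qed.

(** With i = h(v, z)^-1 and k skew, subtracting k (star i) v from z adds 2k - k^2 (star i) i h(v, v)
    to h(z, z), and this expression takes every skew value. The coefficient of v is a multiple of
    pi, so units among the values h(-, z) stay units. *)
Lemma adjust_norm v z t : invertible (h v z) -> star t = - t ->
  exists a, h (z + (pi * a) *: v) (z + (pi * a) *: v) = t.
Proof.
move=> [i di] tS.
have [||r] := skew_quadratic (b := star i * i * h v v) (t := t - h z z).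
- by rewrite !rmorphM (starK ram) form_diag; ring.
- by rewrite rmorphB tS form_diag; ring.
set k := _ * pi => /= kE; exists (- iota r * star i).
have kS : star k = - k by apply/(skewP ram); exists r.
have -> : pi * (- iota r * star i) = - k * star i by rewrite /k; ring.
rewrite !sformDl !sformDr !sformZl !sformZr (sformC v z) !rmorphM (starK ram) rmorphN kS.
have sdi : star (h v z) * star i = 1 by rewrite -rmorphM di rmorph1.
transitivity (h z z + (k * (star (h v z) * star i) + k * (h v z * i) -
  k * k * (star i * i * h v v))); first by ring.
by rewrite di sdi mulr1 -mulr2n kE addrC subrK.
Qed.

Lemma unitary_transitive v w : primitive v -> primitive w -> h v v = h w w ->
  exists2 g, g \in unitary h & g v = w.
Proof.
move=> pv pw vw; have [z [uv uw]] : exists z, invertible (h v z) /\ invertible (h w z).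
  have [x ux] := primitive_form pv; have [y uy] := primitive_form pw.
  have [uwx|[b bE]] := ramified_local ram (h w x); first by exists x.
  have [uvy|[c cE]] := ramified_local ram (h v y); first by exists y.
  exists (x + y); rewrite !sformDr bE cE; split; last rewrite addrC.
    exact: (unit_add_pi ram).
  exact: (unit_add_pi ram).
have [a] := adjust_norm uv (form_diag v); set z' := z + _ => z'z'.
have u1 : invertible (h v z').
  by rewrite /z' sformDr sformZr -mulrA; apply: (unit_add_pi ram).
have u2 : invertible (h w z').
  by rewrite /z' sformDr sformZr -mulrA; apply: (unit_add_pi ram).
have [g1 Ug1 g1v] := reflection_exists (esym z'z') u1.
have [|g2 Ug2 g2w] := reflection_exists _ u2; first by rewrite z'z'.
exists (g1 * g2^-1)%g; first by rewrite (groupM (G := unitary_group h)) // groupV.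
by rewrite permM g1v -g2w permK.
Qed.

Lemma star_half b : b *+ 2 = 1 -> star b = b.
Proof.
move=> b2; apply/eqP; rewrite -subr_eq0; apply/eqP.
apply: (mulr2n_eq0W ram).
by rewrite mulrnBl -rmorphMn b2 rmorph1 subrr.
Qed.

(** A vector z pairing to a unit with a primitive v is made isotropic, giving e. A multiple of v
    then pairs to 1 with e, and adding half its length times e makes it isotropic. *)
Lemma hyperbolic_pair : (0 < m)%N ->
  exists e f, [/\ h e e = 0, h f f = 0 & h e f = 1].
Proof.
move=> m0; pose v : V := const_mx 1.
have pv : primitive v.
  apply/forallP => w; apply/eqP => /(congr1 (fun x : V => x 0 (Ordinal m0))).
  rewrite !mxE => /esym e; apply: (pi_not_unit ram (b := w 0 (Ordinal m0))).
  by exists 1; rewrite mulr1.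
have [z uz] := primitive_form pv.
have s0 : star 0 = - 0 by rewrite rmorph0 oppr0.
have [a] := adjust_norm uz s0.
set e := z + _ => ee0.
have /invertible_formC[i ei] : invertible (h v e).
  by rewrite /e sformDr sformZr -mulrA; apply: (unit_add_pi ram).
have [f ef] : exists f, h e f = 1 by exists (i *: v); rewrite sformZr mulrC.
have [b b2] := half_exists ram.
have bS := star_half b2.
exists e, (f + (b * h f f) *: e); split=> //; last first.
  by rewrite sformDr sformZr ee0 mulr0 addr0.
rewrite !sformDl !sformDr !sformZl !sformZr ee0 ef (sformC e f) ef rmorph1 rmorphM.
rewrite bS form_diag; transitivity (h f f - b *+ 2 * h f f); first by ring.
by rewrite b2 mul1r subrr.
Qed.

Variables (e f : V).
Hypotheses (ee : h e e = 0) (ff : h f f = 0) (ef : h e f = 1).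

Lemma unitary_orbit v : v = 0 \/ exists2 g, g \in unitary h &
  exists k r, (k < 2 * l - 1)%N /\
    g v = pi ^+ k *: e + (pi ^+ k * (iota r * pi)) *: f.
Proof.
have [->|[k [w [kl -> pw]]]] := vec_normal v; [by left|right].
have [b b2] := half_exists ram.
(* For x skew, e + x f has length 2x, so x = h(w, w) / 2 matches the length of w. *)
have /(skewP ram)[r rE] : star (b * h w w) = - (b * h w w).
  by rewrite rmorphM (star_half b2) form_diag mulrN.
pose w' := e + (iota r * pi) *: f.
have fe : h f e = - 1 by rewrite sformC ef rmorph1.
have pw' : primitive w'.
  apply: (form_primitive (w := f)); exists 1.
  by rewrite sformDl sformZl ef ff mulr0 addr0 mulr1.
have kS : star (iota r * pi) = - (iota r * pi) by apply/(skewP ram); exists r.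
have [|g Ug gw] := unitary_transitive pw pw'.
  rewrite !sformDl !sformDr !sformZl !sformZr ee ff ef fe kS -rE.
  transitivity ((b *+ 2) * h w w); last by ring.
  by rewrite b2 mul1r.
exists g => //; exists k, r; split=> //.
have /unitaryP[gL _] := Ug; have := gL (pi ^+ k) w 0.
have g0 : g 0 = 0 by have := gL (-1) 0 0; rewrite scaler0 addr0 scaleN1r addNr.
by rewrite !addr0 g0 addr0 => ->; rewrite gw scalerDr scalerA.
Qed.

End SkewHermitian.

(** * Layers of a Weil module *)

HB.instance Definition _ (B1 B2 : finZmodType) := GRing.Zmodule.on (B1 * B2)%type.

Section DistinctCharacters.
Variables (C : numClosedFieldType) (d k : nat) (B : finZmodType).
Variables (X : 'M[C]_(k, d)) (T : B -> 'M[C]_d) (chi : 'I_k -> B -> C).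
Hypothesis chiD : forall i a b, chi i (a + b) = chi i a * chi i b.
Hypothesis chi0 : forall i, chi i 0 = 1.
Hypothesis XT : forall i b, row i X *m T b = chi i b *: row i X.
Hypothesis X_neq0 : forall i, row i X != 0.
Hypothesis chi_distinct : forall i j, i != j -> exists b, chi i b != chi j b.

(** The sum of [chi j (- b) *: T b] over b kills every row but the j-th, by orthogonality of
    characters, and multiplies that row by |B|. *)
Lemma eigenvectors_free : row_free X.
Proof.
have sum_chi i j : i != j -> \sum_b chi i b * chi j (- b) = 0.
  move=> ij; have [b nb] := chi_distinct ij; set s := (X in X = 0).
  have sE : chi i b * s = chi j b * s.
    rewrite {2}/s (reindex_inj (addrI b)) /= {1}/s !mulr_sumr.
    apply: eq_bigr => a _; rewrite opprD !chiD.
    have e : chi j b * chi j (- b) = 1 by rewrite -chiD subrr chi0.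
    transitivity ((chi j b * chi j (- b)) * (chi i b * (chi i a * chi j (- a)))).
      by rewrite e mul1r.
    by ring.
  by apply/eqP; move/eqP: sE; rewrite -subr_eq0 -mulrBl mulf_eq0 subr_eq0 (negPf nb).
apply: inj_row_free => v; rewrite mulmx_sum_row => v0.
apply/rowP => j; rewrite mxE.
have := congr1 (mulmx^~ (\sum_b chi j (- b) *: T b)) v0; rewrite mul0mx mulmx_suml.
have XE i : row i X *m (\sum_b chi j (- b) *: T b) =
    (\sum_b chi i b * chi j (- b)) *: row i X.
  rewrite mulmx_sumr scaler_suml; apply: eq_bigr => b _.
  by rewrite -scalemxAr XT scalerA mulrC.
rewrite (bigD1 j) //= [X in _ + X]big1 => [|i ij].
  rewrite addr0 -scalemxAl XE scalerA => /eqP; rewrite scaler_eq0 (negPf (X_neq0 j)).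
  rewrite orbF mulf_eq0 => /orP[/eqP //|].
  rewrite (eq_bigr (fun _ => 1)) => [|b _]; last by rewrite -chiD subrr chi0.
  by rewrite sumr_const (negPf (card_zmod_neq0 C B)).
by rewrite -scalemxAl XE sum_chi // scale0r scaler0.
Qed.

End DistinctCharacters.

Section WeilLayers.
Variables (R A : finComNzRingType) (iota : {rmorphism R -> A}).
Variables (star : {rmorphism A -> A}) (F : finType) (l : nat) (p : R) (pi : A).
Hypothesis ram : ramified iota star F l p pi.
Variables (m : nat) (h : 'rV[A]_m -> 'rV[A]_m -> A).
Hypotheses (m_gt0 : (0 < m)%N).
Hypotheses (h_skew : skew_hermitian h star) (h_nondeg : nondegenerate_form h).
Local Notation V := 'rV[A]_m.
Variable f : altForm R V.
Hypothesis fE : forall v w, iota (f v w) *+ 2 = h v w + star (h v w).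
Variables (C : numClosedFieldType) (lambda : R -> C).
Hypothesis lambda_prim : primitive_char lambda.
Local Notation U := (unitary_group h).
Local Notation N := (norm_one_group star m).
Local Notation q := #|F|.

Let lambda0 : lambda 0 = 1. Proof. by case: lambda_prim => -[]. Qed.
Let lambdaD a b : lambda (a + b) = lambda a * lambda b.
Proof. by case: lambda_prim => -[_ ->]. Qed.
Let l1 : (1 < l)%N := ram_l ram.

Lemma iota_inj : injective iota.
Proof.
by move=> x y /eqP; rewrite -subr_eq0 -rmorphB => /eqP/(ram_inj ram)/eqP;
  rewrite subr_eq0 => /eqP.
Qed.

Lemma alt_form_eq v w v' w' : h v w = h v' w' -> f v w = f v' w'.
Proof.
move=> e; apply: iota_inj; apply/eqP; rewrite -subr_eq0; apply/eqP.
by apply: (mulr2n_eq0W ram); rewrite mulrnBl !fE e subrr.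
Qed.

Lemma alt_form0 v w : h v w = 0 -> f v w = 0.
Proof.
move=> e; rewrite (alt_form_eq (v' := 0) (w' := 0)) ?alt0l //.
by rewrite e (sform0l h_skew).
Qed.

(** A multiple of w moves h(v, w) into the minimal ideal, to any prescribed element of p^(l-1) R,
    where lambda is nontrivial. The factor b = 1/2 compensates the doubling. *)
Lemma primitive_detects v w : h v w != 0 ->
  exists c, lambda (f v (c *: w) *+ 2) != 1.
Proof.
move=> nz; have [c0 c0E] := ramified_essential ram nz.
have [y ny] : exists y, lambda (y * p ^+ (l - 1)) != 1.
  apply/existsP; apply: contraT => /existsPn l_1.
  have := p_exp_top_neq0 ram; rewrite (_ : p ^+ (l - 1) = 0) ?eqxx //.
  have [_ prim] := lambda_prim; apply: (prim (principal (p ^+ (l - 1)))).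
  - split; first by exists 0; rewrite mul0r.
      by move=> _ _ [a ->] [b ->]; exists (a + b); rewrite mulrDl.
    by move=> a _ [b ->]; exists (a * b); rewrite mulrA.
  - by move=> _ [a ->]; have := l_1 a; rewrite negbK => /eqP.
  - by exists 1; rewrite mul1r.
have [b b2] := half_exists ram.
exists (c0 * iota y * b); suff -> : f v ((c0 * iota y * b) *: w) *+ 2 = y * p ^+ (l - 1) by [].
apply: iota_inj; rewrite rmorphMn fE (sformZr h_skew).
have -> : c0 * iota y * b * h v w = b * iota (y * p ^+ (l - 1)).
  by rewrite rmorphM -(pi_exp_top ram) -c0E; ring.
by rewrite [star _]rmorphM (star_half ram b2) (ram_star ram) -mulr2n -mulrnAl b2 mul1r.
Qed.

Lemma alt_nondeg v : v != 0 -> exists u, lambda (f u v *+ 2) != 1.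
Proof.
case/(form_neq0 h_skew h_nondeg) => w /primitive_detects[c nc].
by exists (- (c *: w)); rewrite altNl -altC.
Qed.

Lemma unitaryD g : g \in U -> forall u v, g (u + v) = g u + g v.
Proof.
by case/unitaryP => gL _ u v; have := gL 1 u v; rewrite !scale1r.
Qed.

Lemma unitaryZ g : g \in U -> forall a v, g (a *: v) = a *: g v.
Proof.
move=> Ug a v; have := proj1 (unitaryP _ _ Ug) a v 0.
by rewrite !addr0 (_ : g 0 = 0) ?addr0 //; apply: (addrI (g 0)); rewrite -unitaryD ?addr0.
Qed.

Lemma norm_one_unitary : N \subset U.
Proof.
apply/subsetP => g /norm_one_scalarsP[a]; rewrite inE => /eqP aa ga.
apply/unitaryP; split=> [b u v|u v]; rewrite !ga.
  by rewrite scalerDr !scalerA mulrC.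
by rewrite (sformZl h_skew) (sformZr h_skew) mulrA [_ * a]mulrC aa mul1r.
Qed.

Lemma norm_one_abelian : abelian N.
Proof.
apply/centsP => g /norm_one_scalarsP[a _ ga] k /norm_one_scalarsP[b _ kb].
by apply/permP => v; rewrite !permM !ga !kb !scalerA mulrC.
Qed.

Lemma card_norm_one_scalars : #|N| = #|norm_one star|.
Proof.
have aP a : a \in norm_one star -> injective (fun v : V => a *: v).
  rewrite inE => /eqP aa u v /(congr1 (fun w => star a *: w)).
  by rewrite !scalerA mulrC aa !scale1r.
pose g a : {perm V} := odflt 1%g [pick s : {perm V} | [forall v, s v == a *: v]].
have gE a v : a \in norm_one star -> g a v = a *: v.
  move=> Na; rewrite /g; case: pickP => [s /forallP/(_ v)/eqP //|/(_ (perm (aP a Na)))].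
  by move=> /forallPn[w]; rewrite permE eqxx.
rewrite -(card_in_imset (f := g)) => [|a b Na Nb gab].
  apply: eq_card => s; apply/idP/imsetP => [/norm_one_scalarsP[a Na sa]|[a Na ->]].
    by exists a => //; apply/permP => v; rewrite sa gE.
  by apply/norm_one_scalarsP; exists a => // v; apply: gE.
have := gE a (const_mx 1) Na; rewrite gab gE //.
move=> /(congr1 (fun v : V => v 0 (Ordinal m_gt0))).
by rewrite !mxE !mulr1.
Qed.

Lemma norm_one_scalar_exists a : a \in norm_one star ->
  exists2 g, g \in N & forall v, g v = a *: v.
Proof.
move=> Na; have aI : injective (fun v : V => a *: v).
  move: Na; rewrite inE => /eqP aa u v /(congr1 (fun w => star a *: w)).
  by rewrite !scalerA mulrC aa !scale1r.
exists (perm aI) => [|v]; last by rewrite permE.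
by apply/norm_one_scalarsP; exists a => // v; rewrite permE.
Qed.

Variables (d : nat) (S : mx_representation C [set: heisenberg f] d).
Hypothesis S_lambda : schrodinger S lambda.
Variable W : mx_representation C U d.
Hypothesis W_weil : weil S W.
Local Notation T v := (S (heis f 0 v)).

Lemma weilT g v : g \in U -> T v *m W g = W g *m T (g v).
Proof. by move=> Ug; have := (proj1 (weil_intertwines S_lambda W) W_weil) g Ug v. Qed.

(** * The orbit bound for the commutant *)

Section OrbitBound.

(** The exponents k = 2i and 2i+1 contribute equally; the last term q^0 is unpaired, and the added
    1, the orbit of the zero vector, completes it. *)
Lemma sum_halves L : (0 < L)%N ->
  ((\sum_(k < 2 * L - 1) q ^ (L - 1 - k./2)).+1 = 2 * \sum_(i < L) q ^ i)%N.
Proof.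
case: L => // L _; elim: L => [|L IH]; first by rewrite !big_ord1.
rewrite [in RHS]big_ord_recr mulnDr -IH /=.
rewrite (_ : 2 * L.+2 - 1 = (2 * L.+1 - 1).+2)%N; last by lia.
rewrite !big_ord_recl /= (_ : L.+2 - 1 - 0 = L.+1)%N; last by lia.
rewrite [X in (_ + (_ + X))%N](eq_bigr (fun k : 'I_ _ => q ^ (L.+1 - 1 - k./2))%N).
  by move: (\sum_(i < _) _)%N (q ^ _)%N => x y; lia.
by move=> k _; congr (_ ^ _)%N; rewrite /bump /=; lia.
Qed.

Lemma commutant_bound : exists k (M : 'M[C]_(k, d * d)),
  (k <= 2 * \sum_(i < l) q ^ i)%N /\
  forall X, commutes W X -> (mxvec X <= M)%MS.
Proof.
have [e [f1 [ee ff ef]]] := hyperbolic_pair ram h_skew h_nondeg m_gt0.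
pose Zk (k : 'I_(2 * l - 1)) : {set V} :=
  [set pi ^+ k *: e + x *: f1 | x in [set pi ^+ k * (iota r * pi) | r : R]].
pose Z := 0 |: \bigcup_k Zk k.
pose avg v := \sum_(g in U) T (g v).
exists #|Z|, (\matrix_(i < #|Z|) mxvec (avg (enum_val i))); split.
  rewrite -sum_halves ?(ltnW l1) // cardsU1.
  apply: (@leq_trans (1 + \sum_k #|Zk k|)); last first.
    rewrite add1n ltnS; apply: leq_sum => k _.
    by rewrite -(card_pi_skew ram (ltn_ord k)) leq_imset_card.
  apply: leq_add; first by case: (_ \in _).
  elim/big_rec2: _ => [|k s B _ IH]; first by rewrite cards0.
  by rewrite (leq_trans (leq_card_setU _ _)) // leq_add2l.
move=> X cX; have [c defX] := heis_span S_lambda X.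
have avgP v : (mxvec (avg v) <= \matrix_(i < #|Z|) mxvec (avg (enum_val i)))%MS.
  have [z Zz [s Us sv]] : exists2 z, z \in Z & exists2 s, s \in U & s v = z.
    have [->|[s Us [k [r [kl sv]]]]] := unitary_orbit ram h_skew h_nondeg ee ff ef v.
      by exists 0; [rewrite !inE eqxx | exists 1%g; rewrite ?group1 ?perm1].
    exists (s v); last by exists s.
    rewrite sv !inE; apply/orP; right; apply/bigcupP; exists (Ordinal kl) => //.
    by apply/imset_f/imset_f.
  have -> : avg v = avg z.
    rewrite /avg (reindex_inj (mulgI s)) /= -sv; apply: eq_big => [g|g _].
      by rewrite groupMl.
    by rewrite permM.
  by apply: (eq_row_sub (enum_rank_in Zz z)); rewrite rowK enum_rankK_in.
(* Conjugation by each [W g] fixes X and turns [T v] into [T (g v)]; summing over U replaces each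
   [T v] by its orbit sum. *)
have : #|U|%:R *: X = \sum_v c v *: avg v.
  transitivity (\sum_(g in U) invmx (W g) *m X *m W g).
    rewrite (eq_bigr (fun _ => X)) => [|g Ug].
      by rewrite sumr_const scaler_nat.
    by rewrite -mulmxA cX // mulmxA mulVmx ?mul1mx // repr_mx_unit.
  under [RHS]eq_bigr do rewrite scaler_sumr.
  rewrite exchange_big; apply: eq_bigr => g Ug /=.
  rewrite {1}defX mulmx_sumr mulmx_suml; apply: eq_bigr => v _.
  rewrite -scalemxAr -scalemxAl -mulmxA weilT // mulmxA mulVmx ?mul1mx //.
  exact: repr_mx_unit.
have nU : #|U|%:R != 0 :> C by rewrite pnatr_eq0 -lt0n cardG_gt0.
move/(congr1 (fun Y => #|U|%:R^-1 *: Y)); rewrite scalerA mulVf // scale1r => ->.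
rewrite linearZ linear_sum scalemx_sub // summx_sub // => v _.
by rewrite linearZ scalemx_sub //; apply: avgP.
Qed.

End OrbitBound.

Lemma alt_pi0 j k v w : (2 * l - 1 <= j + k)%N ->
  f (pi ^+ j *: v) (pi ^+ k *: w) = 0.
Proof.
move=> jk; apply: alt_form0; rewrite (sformZl h_skew) (sformZr h_skew).
rewrite (star_pi_exp ram) mulrA -(mulrA _ (pi ^+ j)) -exprD.
by rewrite (eqP (_ : pi ^+ (j + k) == 0)) ?mulr0 ?mul0r // (pi_exp_eq0 ram).
Qed.

Definition pi_avg k : 'M[C]_d := heis_avg S (fun v : V => pi ^+ k *: v).

Let piD k (a b : V) : pi ^+ k *: (a + b) = pi ^+ k *: a + pi ^+ k *: b.
Proof. exact: scalerDr. Qed.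

Let pi_iso k : (l <= k)%N -> forall a b : V, f (pi ^+ k *: a) (pi ^+ k *: b) = 0.
Proof. by move=> lk a b; apply: alt_pi0; lia. Qed.

Lemma pi_avg_comm k g : g \in U -> pi_avg k *m W g = W g *m pi_avg k.
Proof.
move=> Ug; apply: (heis_avg_comm (sigma := fun v => g v)) => [|v]; first exact: perm_inj.
by rewrite weilT // unitaryZ.
Qed.

(* The projectors onto the vectors fixed by the isotropic submodules
   r^(2l-1-i) V, for 0 <= i < l. *)
Definition chain i : 'M[C]_d := if (i < l)%N then pi_avg (2 * l - 1 - i) else 0.

Lemma chain0 : chain 0 = 1%:M.
Proof.
rewrite /chain (ltnW l1) subn0 -[pi_avg _]mul1mx; apply/eqP.
have lk : (l <= 2 * l - 1)%N by lia.
apply/(heis_avgP lambda0 S_lambda (piD _) (pi_iso lk)) => v.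
rewrite (eqP (_ : pi ^+ _ == 0)) ?(pi_exp_eq0 ram) // scale0r.
by rewrite (heis0 lambda0 S_lambda) mulmx1.
Qed.

Lemma chainM i j : chain i *m chain j = chain (maxn i j).
Proof.
have le_chain i' j' : (i' <= j')%N -> chain i' *m chain j' = chain j' /\
    chain j' *m chain i' = chain j'.
  move=> ij; rewrite /chain; case: (ltnP j' l) => jl; last by rewrite mulmx0 mul0mx.
  rewrite (leq_ltn_trans ij jl).
  have e v : pi ^+ (2 * l - 1 - i') *: v =
      pi ^+ (2 * l - 1 - j') *: (pi ^+ (j' - i') *: v).
    by rewrite scalerA -exprD; congr (_ ^+ _ *: _); lia.
  have jk : (l <= 2 * l - 1 - j')%N by lia.
  split.
    apply: heis_avg_fixl => v; rewrite e.
    exact: (mul_heis_avg lambda0 S_lambda (piD _) (pi_iso jk)).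
  have ik : (l <= 2 * l - 1 - i')%N by lia.
  apply/eqP/(heis_avgP lambda0 S_lambda (piD _) (pi_iso ik)) => v.
  rewrite e; exact: (heis_avg_mul lambda0 S_lambda (piD _) (pi_iso jk)).
case: (leqP i j) => ij; first by case: (le_chain i j ij).
by case: (le_chain j i (ltnW ij)).
Qed.

Lemma chain_comm i g : g \in U -> chain i *m W g = W g *m chain i.
Proof.
move=> Ug; rewrite /chain; case: ifP => _; last by rewrite mul0mx mulmx0.
exact: pi_avg_comm.
Qed.

Local Notation eps phi := (chi_idem (N := N) W phi).

Let cNN := norm_one_abelian.
Let sNU := norm_one_unitary.

Lemma chi_idem_unitary phi g : g \in U -> eps phi *m W g = W g *m eps phi.
Proof.
move=> Ug; apply: chi_idem_intertwine => k Nk.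
have Uk := subsetP sNU k Nk; rewrite -!repr_mxM //; congr (W _).
have [a _ ka] := norm_one_scalarsP _ _ Nk.
by apply/permP => v; rewrite !permM !ka unitaryZ.
Qed.

Lemma comm_chi_idem (X : 'M[C]_d) phi :
  commutes W X -> eps phi *m X = X *m eps phi.
Proof.
by move=> cX; apply: chi_idem_intertwine => k Nk; rewrite cX // (subsetP sNU).
Qed.

Lemma layer_comm i : commutes W (layer chain i).
Proof. by move=> g Ug; rewrite mulmxBl mulmxBr !chain_comm. Qed.

Definition piece (x : 'I_l * Irr C N) : 'M[C]_d := layer chain x.1 *m eps x.2.

Lemma pieceM x y : piece x *m piece y = piece x *+ (x == y).
Proof.
case: x y => [i phi] [j psi]; rewrite /piece /= mulmxA -(mulmxA (layer _ _)).
rewrite (comm_chi_idem _ (layer_comm j)) !mulmxA -(mulmxA _ (eps phi)) (mul_layer chainM).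
rewrite (chi_idemM cNN sNU) xpair_eqE -[i == j]/(val i == val j).
case: (val i == val j) => /=; last by rewrite !mulr0n mul0mx.
by case: (phi == psi); rewrite /= ?mulr1n ?mulr0n ?mulmx0.
Qed.

Lemma piece_comm x : commutes W (piece x).
Proof.
by move=> g Ug; rewrite -mulmxA chi_idem_unitary // mulmxA layer_comm // mulmxA.
Qed.

Lemma sum_piece_layer i : \sum_phi piece (i, phi) = layer chain i.
Proof. by rewrite /piece /= -mulmx_sumr (sum_chi_idem cNN) mulmx1. Qed.

(** * Characters of N in a single layer *)

Section LayerBound.
Variable i : 'I_l.
Variables (e f1 : V).
Hypotheses (ff : h f1 f1 = 0) (ef : h e f1 = 1).

Let B : finZmodType := (A * V)%type.
(** This parametrizes r^i f1 + r^(2l-1-i) V, which is isotropic since f1 is and the remaining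
    exponents add up to at least 2l-1. *)
Let theta (b : B) : V := (pi ^+ i * b.1) *: f1 + pi ^+ (2 * l - 1 - i) *: b.2.

Let thetaD a b : theta (a + b) = theta a + theta b.
Proof. by rewrite /theta /= mulrDr scalerDl scalerDr addrACA. Qed.

Let theta_iso a b : f (theta a) (theta b) = 0.
Proof.
have il := ltn_ord i.
have f0 : f ((pi ^+ i * a.1) *: f1) ((pi ^+ i * b.1) *: f1) = 0.
  by apply: alt_form0; rewrite (sformZl h_skew) (sformZr h_skew) ff !mulr0.
by rewrite /theta alt_addl !alt_addr f0 -!scalerA !alt_pi0 ?addr0 //; lia.
Qed.

Let theta1 a : theta (a, 0) = (pi ^+ i * a) *: f1.
Proof. by rewrite /theta /= scaler0 addr0. Qed.

Let theta2 v : theta (0, v) = pi ^+ (2 * l - 1 - i) *: v.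
Proof. by rewrite /theta /= mulr0 scale0r add0r. Qed.

Let P := heis_avg S theta.
Let e0 := pi ^+ i *: e.

Lemma norm_one_eigenvector : exists (x : 'rV[C]_d) (phi0 : Irr C N), [/\ x != 0,
  forall b, x *m T (theta b) = x &
  forall g, g \in N -> x *m W g = irr_mode phi0 g *: x].
Proof.
have P0 : P != 0 by exact: (heis_avg_neq0 lambda0 lambdaD S_lambda alt_nondeg thetaD).
have [phi nz] : exists phi : Irr C N, P *m eps phi != 0.
  apply/existsP; apply: contraR P0 => /existsPn Pe0.
  rewrite -[P]mulmx1 -(sum_chi_idem cNN W) mulmx_sumr big1 // => phi _.
  by have := Pe0 phi; rewrite negbK => /eqP.
have Pc g : g \in N -> W g *m P = P *m W g.
  move=> Ng; have [a Na ga] := norm_one_scalarsP _ _ Ng.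
  have aI : injective (fun b : B => (a * b.1, a *: b.2) : B).
    move: Na; rewrite inE => /eqP aa [b v] [b' v'] [eb ev].
    congr (_, _).
      by rewrite -[b]mul1r -[b']mul1r -aa [a * _]mulrC -!mulrA eb.
    by rewrite -[v]scale1r -[v']scale1r -aa [a * _]mulrC -!scalerA ev.
  symmetry; apply: (heis_avg_comm aI) => b; rewrite weilT ?(subsetP sNU) //.
  congr (_ *m S (heis f 0 _)); rewrite ga /theta /= scalerDr !scalerA.
  by rewrite mulrCA [a * pi ^+ (_ - _)]mulrC.
exists (nz_row (P *m eps phi)), phi; rewrite nz_row_eq0 nz.
have /submxP[D ->] := nz_row_sub (P *m eps phi).
split=> // [b|g Ng]; last first.
  by rewrite -!mulmxA (mul_chi_idem cNN sNU) // -!scalemxAr.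
have -> : P *m eps phi = eps phi *m P.
  by symmetry; apply: chi_idem_intertwine => k Nk; apply: Pc.
by rewrite -!mulmxA (heis_avg_mul lambda0 S_lambda thetaD theta_iso).
Qed.

Lemma layer_bound :
  (2 * q ^ (l - 1 - i) <= #|[set phi | piece (i, phi) != 0%R]|)%N.
Proof.
have il := ltn_ord i.
have [x [phi0 [x0 xT xN]]] := norm_one_eigenvector.
pose y v := x *m T v.
have yT v b : y v *m T (theta b) = lambda (f v (theta b) *+ 2) *: y v.
  by rewrite -mulmxA (mul_heisC lambdaD S_lambda) -scalemxAr mulmxA xT.
have y0 v : y v != 0.
  apply: contraNneq x0 => yv0; rewrite -[x]mulmx1.
  by rewrite -(mul_heisN lambda0 S_lambda v) mulmxA -/(y v) yv0 mul0mx.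
have he a b : h (a *: e0) (pi ^+ b *: f1) = star a * ((-1) ^+ i * pi ^+ (i + b)).
  rewrite (sformZl h_skew) (sformZr h_skew) (sformZl h_skew) ef mulr1.
  by rewrite (star_pi_exp ram) exprD; ring.
(* The vector is fixed by r^(2l-1-i) V, which pairs to zero with pi^i e. Some element of r^(2l-2-i)
   f1 multiplies it by a scalar other than 1, so the next projector kills it. *)
have yQ : y e0 *m layer chain i = y e0.
  rewrite mulmxBr; have -> : y e0 *m chain i = y e0.
    rewrite /chain il; have lk : (l <= 2 * l - 1 - i)%N by lia.
    apply/eqP/(heis_avgP lambda0 S_lambda (piD _) (pi_iso lk)) => v.
    by rewrite -theta2 yT theta2 alt_pi0 ?mul0rn ?lambda0 ?scale1r //; lia.
  suff -> : y e0 *m chain i.+1 = 0 by rewrite subr0.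
  rewrite /chain; case: ifP => [il1|_]; last by rewrite mulmx0.
  have [|c nc] := @primitive_detects e0 (pi ^+ (2 * l - 1 - i.+1) *: f1).
    rewrite -[e0]scale1r he rmorph1 mul1r.
    have -> : (i + (2 * l - 1 - i.+1) = 2 * l - 2)%N by lia.
    by rewrite -signr_odd mulr_sign; case: ifP; rewrite ?oppr_eq0 (pi_exp_top_neq0 ram).
  have lk : (l <= 2 * l - 1 - i.+1)%N by lia.
  (* The exponent 2l-2-i splits as i + (2l-2-2i), an exact subtraction since i < l, so the detecting
     vector is a value of [theta]. *)
  move: nc; have -> : c *: (pi ^+ (2 * l - 1 - i.+1) *: f1) =
      theta (pi ^+ (2 * l - 1 - i.+1 - i) * c, 0).
    rewrite theta1 mulrA -exprD scalerA [c * _]mulrC; congr (_ ^+ _ * _ *: _); lia.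
  have bE : theta (pi ^+ (2 * l - 1 - i.+1 - i) * c, 0) =
      pi ^+ (2 * l - 1 - i.+1) *: (c *: f1).
    rewrite theta1 mulrA -exprD scalerA; congr (_ ^+ _ * _ *: _); lia.
  move: (pi ^+ (2 * l - 1 - i.+1 - i) * c, 0) bE => b bE nc.
  have := congr1 (mulmx (y e0)) (mul_heis_avg lambda0 S_lambda (piD _) (pi_iso lk) (c *: f1)).
  rewrite mulmxA -bE yT -scalemxAl => /eqP.
  rewrite -subr_eq0 -[X in _ - X]scale1r -scalerBl scaler_eq0 subr_eq0 (negPf nc).
  by move/eqP.
pose Y := [set a * pi ^+ (2 * i) | a in norm_one star].
apply: leq_trans (leq_card_norm_one ram il) _; rewrite -/Y.
have aP (k : 'I_#|Y|) : exists a, (a \in norm_one star) && (a * pi ^+ (2 * i) == enum_val k).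
  have /imsetP[a Na aE] := enum_valP k; exists a.
  by rewrite Na aE eqxx.
pose al k := xchoose (aP k).
have Nal k : al k \in norm_one star by have /andP[] := xchooseP (aP k).
have alE k : al k * pi ^+ (2 * i) = enum_val k by have /andP[_ /eqP] := xchooseP (aP k).
pose M := \matrix_(k < #|Y|) y (al k *: e0).
have freeM : row_free M.
  apply: (eigenvectors_free (B := A) (T := fun c => T (theta (c, 0)))
    (chi := fun k c => lambda (f (al k *: e0) (theta (c, 0)) *+ 2))).
  - move=> k a b; rewrite -lambdaD -mulrnDl -alt_addr -thetaD.
    congr (lambda (f _ (theta (_, _)) *+ _)).
    by rewrite addr0.
  - by move=> k; rewrite theta1 mulr0 scale0r alt0r mul0rn lambda0.
  - by move=> k c; rewrite rowK yT.
  - by move=> k; rewrite rowK y0.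
  move=> k j kj.
  have [|c nc] := @primitive_detects ((al k - al j) *: e0) (pi ^+ i *: f1).
    rewrite he; have -> : (i + i = 2 * i)%N by lia.
    rewrite mulrCA -signr_odd mulr_sign.
    suff nz : star (al k - al j) * pi ^+ (2 * i) != 0 by case: ifP; rewrite ?oppr_eq0.
    apply: contraNneq kj => /(congr1 star).
    rewrite rmorph0 rmorphM (starK ram) (star_pi_exp ram) [(-1) ^+ _]exprM sqrrN.
    rewrite !expr1n mul1r mulrBl !alE => /eqP.
    by rewrite subr_eq0 (inj_eq enum_val_inj).
  exists c; apply: contra nc => /eqP e1.
  have -> : c *: (pi ^+ i *: f1) = theta (c, 0) by rewrite theta1 scalerA mulrC.
  rewrite scalerBl alt_addl altNl mulrnDl mulNrn lambdaD e1 -lambdaD subrr.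
  by rewrite lambda0.
rewrite -(eqnP freeM); set Phi := [set _ | _].
(* Each row of M is, up to a scalar, an N-translate of [y e0], hence a combination of its components
   for the characters in Phi; the rank of M is thus at most |Phi|. *)
pose M2 := \matrix_(k < #|Phi|) (y e0 *m eps (enum_val k)).
apply: leq_trans (rank_leq_row M2); apply: mxrankS.
apply/row_subP => k; rewrite rowK.
have [g Ng gE] := norm_one_scalar_exists (Nal k).
have Ug := subsetP sNU g Ng.
have : y e0 *m W g = irr_mode phi0 g *: y (al k *: e0).
  by rewrite /y -mulmxA weilT // mulmxA xN // gE scalemxAl.
have nzg : irr_mode phi0 g != 0 by apply: (irr_mode_nz cNN).
move/(congr1 (fun z => (irr_mode phi0 g)^-1 *: z)); rewrite scalerA mulVf // scale1r => <-.
apply: scalemx_sub; rewrite -[y e0 *m _]mulmx1 -(sum_chi_idem cNN W) mulmx_sumr.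
apply: summx_sub => phi _; rewrite -mulmxA -chi_idem_unitary // (mul_chi_idem cNN sNU) //.
rewrite -scalemxAr; apply: scalemx_sub.
have [Pphi|] := boolP (phi \in Phi).
  by apply: (eq_row_sub (enum_rank_in Pphi phi)); rewrite rowK enum_rankK_in.
rewrite inE negbK => /eqP; rewrite /piece /= => pz.
by rewrite -yQ -mulmxA pz mulmx0 sub0mx.
Qed.

End LayerBound.

Lemma card_piece_fibers (I0 : pred 'I_l) :
  #|[set x | I0 x.1 && (piece x != 0)]| =
  (\sum_(i | I0 i) #|[set phi | piece (i, phi) != 0%R]|)%N.
Proof.
rewrite -sum1_card (eq_bigl (fun x => I0 x.1 && (piece x != 0))); last first.
  by move=> x; rewrite inE.
transitivity (\sum_(x : 'I_l * Irr C N | I0 x.1 && (piece (x.1, x.2) != 0%R)) 1)%N.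
  by apply: eq_bigl => -[].
rewrite -(pair_big_dep I0 (fun i phi => piece (i, phi) != 0%R) (fun _ _ => 1%N)) /=.
by apply: eq_bigr => i _; rewrite -sum1_card; apply: eq_bigl => phi; rewrite inE.
Qed.

Lemma sum_powers : (\sum_(i < l) 2 * q ^ (l - 1 - i) = 2 * \sum_(i < l) q ^ i)%N.
Proof.
rewrite big_distrr /= (reindex_inj rev_ord_inj) /=.
by apply: eq_bigr => i _; congr (2 * q ^ _)%N; have := ltn_ord i; lia.
Qed.

Let hyp := hyperbolic_pair ram h_skew h_nondeg m_gt0.

Lemma card_layer_ge (i : 'I_l) :
  (2 * q ^ (l - 1 - i) <= #|[set phi | piece (i, phi) != 0%R]|)%N.
Proof. by have [e [f1 [ee ff ef]]] := hyp; apply: (layer_bound i ff ef). Qed.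

Lemma card_pieces : #|[set x | piece x != 0]| = (2 * \sum_(i < l) q ^ i)%N /\
  forall X x, commutes W X -> exists c, piece x *m X = c *: piece x.
Proof.
have [k [M [kle M_span]]] := commutant_bound.
have ge : (2 * \sum_(i < l) q ^ i <= #|[set x | piece x != 0%R]|)%N.
  rewrite -sum_powers; have := card_piece_fibers xpredT => /= ->.
  by apply: leq_sum => i _; apply: card_layer_ge.
have le := card_idem_le pieceM piece_comm M_span.
split; last first.
  exact: (commutant_scalar pieceM piece_comm M_span (leq_trans kle ge)).
by apply/eqP; rewrite eqn_leq ge (leq_trans le kle).
Qed.

Let piece_scalar := proj2 card_pieces.

(** The lower bounds add up to the exact total, so each of them is an equality. *)
Lemma card_layer (i : 'I_l) :
  #|[set phi | piece (i, phi) != 0]| = (2 * q ^ (l - 1 - i))%N.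
Proof.
have := proj1 card_pieces; have := card_piece_fibers xpredT => /= ->.
rewrite -sum_powers (bigD1 i) //= [in RHS](bigD1 i) //= => e.
apply/eqP; rewrite eqn_leq card_layer_ge andbT.
rewrite -(leq_add2r (\sum_(j < l | j != i) #|[set phi | piece (j, phi) != 0%R]|)).
by rewrite e leq_add2l; apply: leq_sum => j _; apply: card_layer_ge.
Qed.

Let i0 : 'I_l := Ordinal (ltnW l1).

(** Layer 0 carries 2 q^(l-1) = |N| characters, which is all of them. *)
Lemma top_piece_neq0 phi : piece (i0, phi) != 0.
Proof.
have : [set phi | piece (i0, phi) != 0] = [set: Irr C N].
  apply/eqP; rewrite eqEcard subsetT /= cardsT (card_Irr_abelian C cNN).
  by rewrite card_norm_one_scalars (card_norm_one ram) card_layer subn0.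
by move/setP/(_ phi); rewrite !inE.
Qed.

Let J := [set x | (x.1 != i0) && (piece x != 0)].

Lemma card_bot_pieces : #|J| = (2 * \sum_(i < l - 1) q ^ i)%N.
Proof.
have := proj1 card_pieces; have := card_piece_fibers xpredT => /= ->.
rewrite (bigD1 i0) //= card_layer subn0 -(card_piece_fibers (fun i => i != i0)) -/J.
have -> : (\sum_(i < l) q ^ i = \sum_(i < l - 1) q ^ i + q ^ (l - 1))%N.
  by rewrite -[in LHS](subnK (ltnW l1)) addn1 big_ord_recr.
by rewrite mulnDr addnC => /addIn.
Qed.

Lemma sum_piece (I0 : pred 'I_l) :
  \sum_(x | I0 x.1 && (piece x != 0)) piece x = \sum_(i | I0 i) layer chain i.
Proof.
transitivity (\sum_(x : 'I_l * Irr C N | I0 x.1 && true) piece (x.1, x.2)).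
  rewrite big_mkcondr; apply: eq_big => [x|[i phi] _ /=]; first by rewrite andbT.
  by case: eqP => [->|].
rewrite -(pair_big_dep I0 (fun _ _ => true) (fun i phi => piece (i, phi))) /=.
by apply: eq_bigr => i _; rewrite sum_piece_layer.
Qed.

Lemma sum_bot_pieces : \sum_(x in J) piece x = chain 1.
Proof.
rewrite (eq_bigl (fun x => (x.1 != i0) && (piece x != 0))) => [|x]; last by rewrite inE.
rewrite (sum_piece (fun i => i != i0)).
have := sum_layer chain (leq0n l); rewrite big_mkord (bigD1 i0) //=.
have -> : chain l = 0 by rewrite /chain ltnn.
rewrite subr0 => e; apply: (addrI (layer chain 0)); apply: etrans e _.
by rewrite /layer subrK.
Qed.

Definition bot_vectors : {set V} := [set pi ^+ (2 * l - 2) *: v | v in [set: V]].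
Local Notation Bot := (fixed_by S bot_vectors).

Lemma bot_chain : (chain 1 :=: Bot)%MS.
Proof.
have lk : (l <= 2 * l - 1 - 1)%N by lia.
have c1 : chain 1 = pi_avg (2 * l - 2).
  by rewrite /chain l1; congr (pi_avg _); lia.
apply/eqmxP/andP; split.
  apply/rfix_mxP => _ /imsetP[_ /imsetP[v _ ->] ->]; rewrite c1.
  by apply: (heis_avg_mul lambda0 S_lambda (piD _) (pi_iso _)); lia.
set B := fixed_by _ _; suff /eqP <- : B *m chain 1 == B by apply: submxMl.
rewrite c1; apply/(heis_avgP lambda0 S_lambda (piD _) (pi_iso _)) => [|v]; first lia.
by apply: rfix_mx_id; apply/imset_f/imset_f; rewrite inE.
Qed.

Lemma bot_module : mxmodule W Bot.
Proof.
rewrite -(eqmx_module _ bot_chain); apply/mxmoduleP => g Ug.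
by rewrite chain_comm // submxMl.
Qed.

(** The blocks are the nonzero pieces outside layer 0. The second clause keeps what separates them
    from the constituents of Top. *)
Lemma bot_decomposition : exists2 B : 'I_(2 * \sum_(i < l - 1) q ^ i) -> 'M[C]_d,
    mult_free_decomposition W Bot B
  & forall j, [/\ B j *m B j = B j, B j != 0, commutes W (B j),
      B j *m layer chain i0 = 0 &
      forall X, commutes W X -> exists c, B j *m X = c *: B j].
Proof.
rewrite -card_bot_pieces; pose idx (j : 'I_#|J|) := enum_val j.
have idxI : injective idx by apply: enum_val_inj.
have idxJ j : idx j \in J by apply: enum_valP.
exists (fun j => piece (idx j)); last first.
  move=> j; have := idxJ j; rewrite inE => /andP[ni nz].
  split=> //.
  - by rewrite pieceM eqxx.
  - exact: piece_comm.
  - rewrite /piece -mulmxA (comm_chi_idem _ (layer_comm i0)) mulmxA (mul_layer chainM).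
    by rewrite -[_ == _]/((idx j).1 == i0) (negPf ni) mul0mx.
  - by move=> X; apply: piece_scalar.
have BB j k : piece (idx j) *m piece (idx k) = piece (idx j) *+ (j == k).
  by rewrite pieceM (inj_eq idxI).
have nz j : piece (idx j) != 0 by have := idxJ j; rewrite inE => /andP[].
have cB j : commutes W (piece (idx j)) by apply: piece_comm.
have scB X j : commutes W X -> exists c, piece (idx j) *m X = c *: piece (idx j).
  exact: piece_scalar.
split=> [j|||j k].
- exact: (commutant_simple (pgroup_pchar_num C U) cB scB (nz j)).
- apply: eqmx_trans bot_chain; apply: sumsmx_idem => //.
  by rewrite -sum_bot_pieces big_enum_val.
- exact: mxdirect_idem BB xpredT.
- exact: (commutant_iso BB cB scB (nz j)).
Qed.

Local Notation Top := (factmod_repr bot_module).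
Local Notation Top_ phi := (joint_eigenspace Top N (irr_mode (phi : Irr C N))).

(** The image of layer 0 is an invariant complement of Bot, so the properties of its pieces transfer
    to Top. *)
Lemma top_decomposition : mult_free_decomposition Top 1%:M (fun phi => Top_ phi) /\
  forall (B : 'M[C]_d) (modB : mxmodule W B) M (modM : mxmodule Top M),
    [/\ B *m B = B, B != 0, commutes W B, B *m layer chain i0 = 0 &
      forall X, commutes W X -> exists c, B *m X = c *: B] ->
    ~ mx_rsim (submod_repr modB) (submod_repr modM).
Proof.
have PP : chain 1 *m chain 1 = chain 1 by rewrite chainM.
have cP : commutes W (chain 1) by move=> g; apply: chain_comm.
have layerE : 1%:M - chain 1 = layer chain i0 by rewrite /layer /= chain0.
have [proj [sec [sp ps hp hs]]] := factmod_section bot_module PP cP bot_chain.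
rewrite layerE in ps; split.
  apply: (compl_mult_free cNN sNU sp ps hp hs) => [X phi|phi|phi].
  - exact: (piece_scalar (i0, phi)).
  - exact: top_piece_neq0.
  - exact: (piece_comm (i0, phi)).
move=> B modB M modM [BB B0 cB BQ scB].
exact: (compl_not_rsim sp ps hs BB B0 cB BQ scB).
Qed.

End WeilLayers.

(** * The bottom layer as a Weil module *)

Section BottomLayer.
Variables (R A : finComNzRingType) (iota : {rmorphism R -> A}).
Variables (star : {rmorphism A -> A}) (F : finType) (l : nat) (p : R) (pi : A).
Hypothesis ram : ramified iota star F l p pi.
Variables (m : nat) (h : 'rV[A]_m -> 'rV[A]_m -> A).
Hypotheses (m_gt0 : (0 < m)%N).
Hypotheses (h_skew : skew_hermitian h star) (h_nondeg : nondegenerate_form h).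
Local Notation V := 'rV[A]_m.
Variable f : altForm R V.
Hypothesis fE : forall v w, iota (f v w) *+ 2 = h v w + star (h v w).
Variables (Rbar Abar : finComNzRingType).
Variables (piR : {rmorphism R -> Rbar}) (piA : {rmorphism A -> Abar}).
Hypotheses (piRP : is_quotient piR (p ^+ (l - 1)))
  (piAP : is_quotient piA (pi ^+ (2 * l - 3))).
Local Notation Vbar := 'rV[Abar]_m.
Variable hbar : Vbar -> Vbar -> Abar.
Hypothesis hbarE : forall v w, hbar (map_mx piA v) (map_mx piA w) = piA (h v w).
Variable fbar : altForm Rbar Vbar.
Hypothesis fbarE : forall v w, fbar (map_mx piA v) (map_mx piA w) = piR (f v w).
Variables (C : numClosedFieldType) (lambda : R -> C).
Hypothesis lambda_prim : primitive_char lambda.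
Local Notation U := (unitary_group h).
Local Notation Ubar := (unitary_group hbar).

Let lambda0 : lambda 0 = 1. Proof. by case: lambda_prim => -[]. Qed.
Let lambdaD a b : lambda (a + b) = lambda a * lambda b.
Proof. by case: lambda_prim => -[_ ->]. Qed.
Let l1 : (1 < l)%N := ram_l ram.

Lemma lift_vec (x : Vbar) : exists v, map_mx piA v == x.
Proof.
have /fin_all_exists[v vE] (j : 'I_m) : exists a, piA a = x 0 j by apply: (proj1 piAP).
by exists (\row_j v j); apply/eqP/rowP => j; rewrite !mxE vE.
Qed.

Lemma lift_scal (x : Rbar) : exists r, piR r == x.
Proof. by have [r <-] := proj1 piRP x; exists r. Qed.

Definition liftV x := xchoose (lift_vec x).
Definition liftR x := xchoose (lift_scal x).

Lemma liftVK x : map_mx piA (liftV x) = x. Proof. exact: eqP (xchooseP (lift_vec x)). Qed.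
Lemma liftRK x : piR (liftR x) = x. Proof. exact: eqP (xchooseP (lift_scal x)). Qed.

Lemma map_vec_eq (v w : V) : map_mx piA v = map_mx piA w ->
  exists u, v = pi ^+ (2 * l - 3) *: u + w.
Proof.
move=> e; have /fin_all_exists[u uE] (j : 'I_m) :
    exists b, v 0 j - w 0 j = b * pi ^+ (2 * l - 3).
  apply/(proj2 piAP); have := congr1 (fun x : Vbar => x 0 j) e.
  by rewrite !mxE rmorphB => ->; rewrite subrr.
exists (\row_j u j); apply/rowP => j.
by rewrite !mxE mulrC -uE subrK.
Qed.

Lemma map_vec_pi (u : V) : map_mx piA (pi ^+ (2 * l - 3) *: u) = 0.
Proof.
apply/rowP => j; rewrite !mxE; apply/(proj2 piAP); exists (u 0 j).
by rewrite mulrC.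
Qed.

Lemma alt_pi v w : f (pi *: v) (pi *: w) = - (p * f v w).
Proof.
apply: (iota_inj ram); apply/eqP; rewrite -subr_eq0; apply/eqP.
apply: (mulr2n_eq0W ram); rewrite mulrnBl fE (sformZl h_skew) (sformZr h_skew).
rewrite rmorphN [iota (p * _)]rmorphM mulNrn -mulrnAr fE -(ram_sqr ram).
by rewrite !rmorphM (starK ram) (ram_star_pi ram); ring.
Qed.

Lemma p_ann r : p * r = 0 -> exists y, r = y * p ^+ (l - 1).
Proof.
move=> pr; suff /(_ (l - 1)%N (leqnn _)) [y ->] :
    forall k, (k <= l - 1)%N -> exists y, r = p ^+ k * y.
  by exists y; rewrite mulrC.
elim=> [|k IH] kl; first by exists r; rewrite mul1r.
have [y yE] := IH (ltnW kl).
have [||z zE] := ram_val ram (i := k.+1) (r := y) (r' := 0); first lia.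
  by rewrite mulr0 exprS -mulrA -yE.
by exists z; rewrite yE zE mulrA -exprSr.
Qed.

(** The sign comes from [alt_pi]; the factor p makes the value independent of the lift, because p
    p^(l-1) = 0. *)
Definition mu (x : Rbar) : C := lambda (- (p * liftR x)).

Lemma mu_piR r : mu (piR r) = lambda (- (p * r)).
Proof.
have /(proj2 piRP)[y yE] : piR (liftR (piR r) - r) = 0.
  by rewrite rmorphB liftRK subrr.
rewrite /mu -[liftR _](subrK r) yE mulrDr mulrCA -exprS.
rewrite (_ : (l - 1).+1 = l); last by lia.
by rewrite (ram_pl ram) mulr0 add0r.
Qed.

Lemma mu_primitive : primitive_char mu.
Proof.
split=> [|I [I0 ID IM] I1 x Ix].
  split=> [|a b]; first by rewrite -(rmorph0 piR) mu_piR mulr0 oppr0.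
  rewrite -[a]liftRK -[b]liftRK -rmorphD !mu_piR mulrDr opprD; exact: lambdaD.
have [_ prim] := lambda_prim.
have : p * liftR x = 0.
  (* An ideal in the kernel of mu, pulled back to R and multiplied by p, is an ideal in the kernel
     of lambda. *)
  apply: (prim (fun r => exists2 y, I (piR y) & r = p * y)); last first.
  - by exists (liftR x); rewrite ?liftRK.
  - move=> _ [y Iy ->]; have Iny : I (piR (- y)).
      by rewrite rmorphN -mulN1r; apply: IM.
    by have := I1 _ Iny; rewrite mu_piR mulrN opprK.
  split.
  - by exists 0; rewrite ?mulr0 ?rmorph0.
  - move=> _ _ [y Iy ->] [z Iz ->]; exists (y + z); last by rewrite mulrDr.
    by rewrite rmorphD; apply: ID.
  - move=> a _ [y Iy ->]; exists (a * y); last by rewrite mulrCA.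
    by rewrite rmorphM; apply: IM.
move=> /p_ann lx; rewrite -[x]liftRK; exact/(proj2 piRP).
Qed.

Let mu0 : mu 0 = 1. Proof. by case: mu_primitive => -[]. Qed.
Let muD a b : mu (a + b) = mu a * mu b.
Proof. by case: mu_primitive => -[_ ->]. Qed.

Lemma mu_alt (v w : V) :
  mu (fbar (map_mx piA v) (map_mx piA w)) = lambda (f (pi *: v) (pi *: w)).
Proof. by rewrite fbarE mu_piR alt_pi. Qed.

(** A lift v of x is nonzero modulo r^(2l-3), so pi^2 v is nonzero; hence pi v pairs nontrivially
    with some pi w. *)
Lemma mu_nondeg (x : Vbar) : x != 0 -> exists y, mu (fbar y x *+ 2) != 1.
Proof.
move=> x0; have [v vx] := lift_vec x; move/eqP: vx x0 => <- v0.
have pv : pi ^+ 2 *: v != 0.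
  apply: contraNneq v0 => /(vec_ann ram) [|u ->]; first by lia.
  by rewrite (_ : 2 * l - 1 - 2 = 2 * l - 3)%N ?map_vec_pi //; lia.
have [w nz] := form_neq0 h_skew h_nondeg pv.
have [|c nc] := primitive_detects ram h_skew fE lambda_prim (v := pi *: v) (w := pi *: w).
  apply: contraNneq nz; rewrite !(sformZl h_skew) !(sformZr h_skew).
  rewrite (star_pi_exp ram) (ram_star_pi ram) => e; apply/eqP.
  by apply: oppr_inj; rewrite oppr0 -[RHS]e; ring.
exists (- map_mx piA (c *: w)); rewrite altNl -altC mulr2n muD mu_alt -lambdaD -mulr2n.
by rewrite scalerA mulrC -scalerA.
Qed.

(** On lifts, h is preserved up to b pi^(2l-3). The exponent is odd, so the sum of this error and
    its conjugate is 2 r' p^(l-1) with r' the pi-coordinate of b, which is zero in the quotient of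
    R. *)
Lemma fbar_unitary g : g \in Ubar -> forall x y, fbar (g x) (g y) = fbar x y.
Proof.
move=> /unitaryP[_ gh] x y; have := gh x y.
rewrite -[x]liftVK -[y]liftVK; set x' := g _; set y' := g _.
rewrite -[x']liftVK -[y']liftVK !hbarE !fbarE.
move: (liftV x) (liftV y) (liftV x') (liftV y') => {x y x' y' gh} x y x' y' e.
have /(proj2 piAP)[b bE] : piA (h x' y' - h x y) = 0 by rewrite rmorphB e subrr.
apply/eqP; rewrite -subr_eq0 -rmorphB; apply/eqP/(proj2 piRP).
have [r [r' bd]] := ram_dec ram b; exists r'.
apply: (iota_inj ram); apply/eqP; rewrite -subr_eq0; apply/eqP.
apply: (mulr2n_eq0W ram).
rewrite mulrnBl -[iota _ *+ 2]rmorphMn mulrnBl rmorphB !rmorphMn !fE.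
have -> : h x' y' = h x y + b * pi ^+ (2 * l - 3) by rewrite -bE addrC subrK.
have kS : star (pi ^+ (2 * l - 3)) = - pi ^+ (2 * l - 3).
  rewrite (star_pi_exp ram) (_ : 2 * l - 3 = (l - 2).*2.+1)%N; last by lia.
  by rewrite -signr_odd /= odd_double expr1 mulN1r.
have topE : iota (p ^+ (l - 1)) = pi ^+ (2 * l - 3) * pi.
  by rewrite -(pi_exp_top ram) -exprSr; congr (_ ^+ _); lia.
rewrite [star (_ + _)]rmorphD [star (b * _)]rmorphM kS [iota (r' * _)]rmorphM topE bd.
by rewrite rmorphD rmorphM !(ram_star ram) (ram_star_pi ram); ring.
Qed.

Variables (d : nat) (S : mx_representation C [set: heisenberg f] d).
Hypothesis S_lambda : schrodinger S lambda.
Variable W : mx_representation C U d.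
Hypothesis W_weil : weil S W.
Local Notation T v := (S (heis f 0 v)).
Local Notation k0 := (2 * l - 2)%N.

(** * Compression to the bottom layer *)

Section Corner.
Variables (D : nat) (iB : 'M[C]_(D, d)) (kB : 'M[C]_(d, D)).
Hypothesis iBkB : iB *m kB = 1%:M.
Hypothesis iB_fix : forall v, iB *m T (pi ^+ k0 *: v) = iB.
Hypothesis kBiB : forall k (X : 'M[C]_(k, d)),
  (forall v, X *m T (pi ^+ k0 *: v) = X) -> X *m kB *m iB = X.

Variable P : 'M[C]_d.
Hypothesis P_neq0 : P != 0.
Hypothesis P_fix : forall v, P *m T (pi ^+ k0 *: v) = P.
Hypothesis fix_P : forall v, T (pi ^+ k0 *: v) *m P = P.
Hypothesis mulP : forall k (X : 'M[C]_(k, d)),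
  (forall v, X *m T (pi ^+ k0 *: v) = X) -> X *m P = X.

Lemma corner_gt0 : (0 < D)%N.
Proof.
rewrite lt0n; apply/eqP => D0; have := P_neq0.
have iB0 : iB = 0 by apply/matrixP => j; have := ltn_ord j; rewrite {2}D0.
by rewrite -(kBiB P_fix) iB0 mulmx0 eqxx.
Qed.

Definition corner (X : 'M[C]_d) : 'M[C]_D := iB *m X *m kB.

Lemma cornerM X Y : (forall v, iB *m X *m T (pi ^+ k0 *: v) = iB *m X) ->
  corner X *m corner Y = corner (X *m Y).
Proof. by move=> /kBiB XB; rewrite /corner !mulmxA XB. Qed.

Lemma corner_heis_fix u v :
  iB *m T (pi *: u) *m T (pi ^+ k0 *: v) = iB *m T (pi *: u).
Proof.
rewrite -mulmxA (mul_heisC lambdaD S_lambda) (_ : f _ _ = 0).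
  by rewrite mul0rn lambda0 scale1r mulmxA iB_fix.
by rewrite -[pi in pi *: u]expr1; apply: (alt_pi0 ram h_skew fE); lia.
Qed.

(** Changing v by r^(2l-3) V changes pi v by r^(2l-2) V, which acts trivially on Bot. *)
Lemma corner_heis_eq (v w : V) : map_mx piA v = map_mx piA w ->
  iB *m T (pi *: v) = iB *m T (pi *: w).
Proof.
move=> /map_vec_eq[u ->]; rewrite scalerDr scalerA -exprS.
rewrite (_ : (2 * l - 3).+1 = k0); last by lia.
rewrite -[in RHS](iB_fix u) -mulmxA (mul_heis S_lambda) (_ : f _ _ = 0).
  by rewrite lambda0 scale1r.
by rewrite -[pi in pi *: w]expr1; apply: (alt_pi0 ram h_skew fE); lia.
Qed.

Definition Sbar_fun (x : heisenberg fbar) : 'M[C]_D :=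
  mu x.1 *: corner (T (pi *: liftV x.2)).

Lemma Sbar_funE a v : Sbar_fun (heis fbar a (map_mx piA v)) =
  mu a *: corner (T (pi *: v)).
Proof. by rewrite /Sbar_fun /corner (corner_heis_eq (w := v)) // liftVK. Qed.

Lemma Sbar_repr : mx_repr [set: heisenberg fbar] Sbar_fun.
Proof.
split=> [|[a x] [b y] _ _].
  have -> : (1%g : heisenberg fbar) = heis fbar 0 (map_mx piA 0).
    by rewrite map_mx0.
  rewrite Sbar_funE mu0 scale1r scaler0 (heis0 lambda0 S_lambda).
  by rewrite /corner mulmx1 iBkB.
rewrite -[(a, x)]/(heis fbar a x) -[(b, y)]/(heis fbar b y) heisM.
rewrite -[x]liftVK -[y]liftVK -map_mxD !Sbar_funE -scalemxAl -scalemxAr scalerA.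
rewrite cornerM; last exact: corner_heis_fix.
rewrite (mul_heis S_lambda) -scalerDr -mu_alt muD muD /corner.
by rewrite -scalemxAr -scalemxAl scalerA.
Qed.

Definition Sbar := MxRepresentation Sbar_repr.

Lemma Sbar_heis a v : Sbar (heis fbar a (map_mx piA v)) = mu a *: corner (T (pi *: v)).
Proof. exact: Sbar_funE. Qed.

(** For primitive v, [T v] sends Bot into a nontrivial character space of r^(2l-2) V, and P kills
    that space. *)
Lemma corner_heis_not_pi v : primitive pi v -> iB *m T v *m P = 0.
Proof.
case/(primitive_form ram h_skew h_nondeg) => w [b wb].
have [|c nc] := primitive_detects ram h_skew fE lambda_prim (v := v) (w := pi ^+ k0 *: w).
  rewrite (sformZr h_skew); apply: contraNneq (pi_exp_top_neq0 ram) => e.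
  by rewrite -[pi ^+ _]mulr1 -wb mulrA e mul0r.
move: nc; rewrite scalerA mulrC -scalerA => nc.
have : iB *m T v *m P = lambda (f v (pi ^+ k0 *: (c *: w)) *+ 2) *: (iB *m T v *m P).
  rewrite -[in LHS](fix_P (c *: w)) mulmxA -(mulmxA iB) (mul_heisC lambdaD S_lambda).
  by rewrite -scalemxAr -scalemxAl !mulmxA iB_fix.
move/eqP; rewrite -subr_eq0 -[X in X - _]scale1r -scalerBl scaler_eq0 subr_eq0.
by rewrite eq_sym (negPf nc) => /eqP.
Qed.

(** Any matrix on Bot extends to X and expands in the [T v]. After compression only the v in pi V
    survive, so the operators of [Sbar] span all matrices on Bot. *)
Lemma Sbar_schrodinger : schrodinger Sbar mu.
Proof.
split=> [|a]; last first.
  rewrite -(map_mx0 piA) Sbar_heis scaler0 (heis0 lambda0 S_lambda).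
  by rewrite /corner mulmx1 iBkB scalemx1.
apply: mx_abs_irrW; apply/andP; split; first exact: corner_gt0.
rewrite -sub1mx; apply/row_subP => i; rewrite -[row i _]vec_mxK.
move: (vec_mx _) => Y; have [c cE] := heis_span S_lambda (kB *m Y *m iB).
have -> : Y = \sum_v c v *: (iB *m T v *m P *m kB).
  transitivity (iB *m (kB *m Y *m iB) *m P *m kB).
    by rewrite -!mulmxA (mulmxA iB P) (mulP iB_fix) iBkB mulmx1 mulmxA iBkB mul1mx.
  rewrite cE mulmx_sumr !mulmx_suml; apply: eq_bigr => v _.
  by rewrite -scalemxAr -!scalemxAl.
rewrite linear_sum summx_sub // => v _; rewrite linearZ scalemx_sub //.
have [/corner_heis_not_pi ->|[u ->]] := primitiveP pi v.
  by rewrite mul0mx linear0 sub0mx.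
have -> : iB *m T (pi *: u) *m P = iB *m T (pi *: u).
  by apply: mulP => w; apply: corner_heis_fix.
have := envelop_mx_id Sbar (x := heis fbar 0 (map_mx piA u)) (in_setT _).
by rewrite Sbar_heis mu0 scale1r.
Qed.

Lemma unitary_map_eq g (v w : V) : g \in U -> map_mx piA v = map_mx piA w ->
  map_mx piA (g v) = map_mx piA (g w).
Proof.
move=> Ug /map_vec_eq[u ->].
by rewrite (unitaryD Ug) (unitaryZ Ug) map_mxD map_vec_pi add0r.
Qed.

Lemma induced_unitary g : g \in U -> exists s : {perm Vbar},
  (s \in Ubar) && [forall v, s (map_mx piA v) == map_mx piA (g v)].
Proof.
move=> Ug; pose s x := map_mx piA (g (liftV x)).
have sE v : s (map_mx piA v) = map_mx piA (g v).
  by apply: unitary_map_eq; rewrite // liftVK.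
have sI : injective s.
  move=> x y sxy; rewrite -[x]liftVK -[y]liftVK -[liftV x](permK g) -[liftV y](permK g).
  by apply: unitary_map_eq; rewrite ?groupV.
exists (perm sI); apply/andP; split; last by apply/forallP => v; rewrite permE sE.
have [gL gh] := unitaryP _ _ Ug; apply/unitaryP; split=> [a x y|x y]; rewrite !permE.
  have [b bE] := proj1 piAP a; rewrite -[x]liftVK -[y]liftVK -bE -map_mxZ -map_mxD !sE.
  by rewrite gL map_mxD map_mxZ.
by rewrite -[x]liftVK -[y]liftVK !sE !hbarE gh.
Qed.

Lemma bottom_weil : exists (chi : {perm V} -> C) (mub : Rbar -> C)
    (Sb : mx_representation C [set: heisenberg fbar] D)
    (Wb : mx_representation C Ubar D),
  [/\ lin_char U chi, primitive_char mub, schrodinger Sb mub, weil Sb Wb &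
   forall g, g \in U -> exists gbar, [/\ gbar \in Ubar,
     forall v, gbar (map_mx piA v) = map_mx piA (g v) &
     corner (W g) = chi g *: Wb gbar]].
Proof.
have [Wbar Wb] := weil_exists mu0 muD Sbar_schrodinger mu_nondeg
  (fun g Ug => unitaryD Ug) fbar_unitary.
pose gb (g : {perm V}) : {perm Vbar} := odflt 1%g [pick s : {perm Vbar} |
  (s \in Ubar) && [forall v, s (map_mx piA v) == map_mx piA (g v)]].
have gbP g : g \in U -> gb g \in Ubar /\ forall v, gb g (map_mx piA v) = map_mx piA (g v).
  move=> /induced_unitary[s sP]; rewrite /gb; case: pickP => [s' /andP[Us' /forallP s'E]|].
    by split=> // v; apply/eqP.
  by move/(_ s); rewrite sP.
have gbM : {in U &, {morph gb : x y / (x * y)%g}}.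
  move=> x y Ux Uy; apply/permP => v; rewrite -[v]liftVK permM.
  have [_ ->] := gbP _ (groupM Ux Uy); have [_ ->] := gbP _ Ux.
  by have [_ ->] := gbP _ Uy; rewrite permM.
have W_fix g : g \in U -> forall v, iB *m W g *m T (pi ^+ k0 *: v) = iB *m W g.
  move=> Ug v; rewrite -mulmxA -[v](permKV g) -(unitaryZ Ug) -(weilT S_lambda W_weil) //.
  by rewrite mulmxA iB_fix.
have cornerW : {in U &, {morph (fun g => corner (W g)) : x y / (x * y)%g >-> x *m y}}.
  move=> x y Ux Uy; rewrite cornerM; first by rewrite repr_mxM.
  exact: (W_fix x Ux).
have corner1 : corner (W 1%g) = 1%:M by rewrite /corner repr_mx1 mulmx1 iBkB.
have ex g : exists a, (g \in U) ==> (corner (W g) == a *: Wbar (gb g)).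
  have [Ug|nUg] := boolP (g \in U); last by exists 0.
  have [Ub gbE] := gbP g Ug.
  (* Both [corner (W g)] and [Wbar (gb g)] intertwine [Sbar] along the induced isometry, so Schur's
     lemma makes them proportional; the ratio defines the linear character. *)
  have [|a aE] := intertwiner_scalar Sbar_schrodinger (g := gb g) (Y := corner (W g))
      (repr_mx_unit Wbar Ub) (proj1 (weil_intertwines Sbar_schrodinger Wbar) Wb _ Ub).
    move=> x; rewrite -[x]liftVK gbE !Sbar_heis mu0 !scale1r.
    rewrite (cornerM _ (corner_heis_fix _)) (cornerM _ (W_fix g Ug)).
    by rewrite (weilT S_lambda W_weil) // (unitaryZ Ug).
  by exists a; apply/eqP.
pose chi g := xchoose (ex g).
have chiP g : g \in U -> corner (W g) = chi g *: Wbar (gb g).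
  by move=> Ug; have /implyP/(_ Ug)/eqP := xchooseP (ex g).
have cancel (s : {perm Vbar}) a b : s \in Ubar -> a *: Wbar s = b *: Wbar s -> a = b.
  move=> Us /(congr1 (mulmx^~ (invmx (Wbar s)))).
  rewrite -!scalemxAl mulmxV ?repr_mx_unit // !scalemx1 => /matrixP.
  by move=> /(_ (Ordinal corner_gt0) (Ordinal corner_gt0)); rewrite !mxE eqxx.
exists chi, mu, Sbar, Wbar; split;
  [|exact: mu_primitive|exact: Sbar_schrodinger|exact: Wb|]; last first.
  by move=> g Ug; exists (gb g); have [Ub gbE] := gbP g Ug; split=> //; apply: chiP.
have gb1 : gb 1%g = 1%g.
  by apply: (mulgI (gb 1%g)); rewrite -gbM ?group1 // !mulg1.
split.
  apply: (cancel 1%g); rewrite ?group1 // -gb1 -chiP ?group1 // corner1 gb1.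
  by rewrite repr_mx1 scale1r.
move=> x y Ux Uy; have [Ubx _] := gbP x Ux; have [Uby _] := gbP y Uy.
apply: (cancel (gb x * gb y)%g); first exact: groupM.
rewrite -gbM // -chiP ?groupM // cornerW // !chiP // gbM // repr_mxM //.
by rewrite -scalemxAl -scalemxAr scalerA.
Qed.

End Corner.

End BottomLayer.

(** * From the abstract ramified setting to the given rings and forms *)

Theorem mainTheorem6
  (* the rings O, O/Os = F_q, R = O/Os^l, A = (O[X]/(X^2 - s))/(t^(2l-1)) *)
  (O : idomainType) (s : O)
  (O_pid : principal_ideal_ring O) (O_local : local_with_maximal s)
  (O_not_field : exists2 x : O, x != 0 & x \isn't a GRing.unit)
  (F : finFieldType) (residue : {rmorphism O -> F})
  (residueP : is_quotient residue s) (F_odd : 2%N \notin [pchar F])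
  (l : nat) (l_gt1 : (1 < l)%N)
  (R A : finComNzRingType)
  (rhoR : {rmorphism O -> R}) (rhoRP : is_quotient rhoR (s ^+ l))
  (rhoA : {rmorphism {poly %/ 'X^2 - s%:P} -> A})
  (rhoAP : is_quotient rhoA ('qX ^+ (2 * l - 1)))
  (iota : {rmorphism R -> A})
  (iotaE : forall x : O, iota (rhoR x) = rhoA (qpolyC ('X^2 - s%:P) x))
  (star : {rmorphism A -> A})
  (star_R : forall r : R, star (iota r) = iota r)
  (star_pi : star (rhoA 'qX) = - rhoA 'qX)
  (* V = A^(2n), the form h, and the alternating form f = (h + h^* )/2 *)
  (n : nat) (n_gt0 : (0 < n)%N)
  (h : 'rV[A]_(2 * n) -> 'rV[A]_(2 * n) -> A)
  (h_skew : skew_hermitian h star) (h_nondeg : nondegenerate_form h)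
  (f : altForm R 'rV[A]_(2 * n))
  (fE : forall v w, iota (f v w) *+ 2 = h v w + star (h v w))
  (* the quotients of R, A, V = A^(2n), and the induced forms *)
  (Rbar Abar : finComNzRingType)
  (piR : {rmorphism R -> Rbar}) (piRP : is_quotient piR (rhoR s ^+ (l - 1)))
  (piA : {rmorphism A -> Abar})
  (piAP : is_quotient piA (rhoA 'qX ^+ (2 * l - 3)))
  (hbar : 'rV[Abar]_(2 * n) -> 'rV[Abar]_(2 * n) -> Abar)
  (hbarE : forall v w, hbar (map_mx piA v) (map_mx piA w) = piA (h v w))
  (fbar : altForm Rbar 'rV[Abar]_(2 * n))
  (fbarE : forall v w, fbar (map_mx piA v) (map_mx piA w) = piR (f v w))
  (* the Weil representation W of U of type lambda, on X = C^d *)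
  (C : numClosedFieldType)
  (lambda : R -> C) (lambda_prim : primitive_char lambda)
  (d : nat) (S : mx_representation C [set: heisenberg f] d)
  (S_lambda : schrodinger S lambda)
  (W : mx_representation C (unitary_group h) d) (W_weil : weil S W) :
  let q := #|F| in
  let N := norm_one_group star (2 * n) in
  let nV := [set rhoA 'qX ^+ (2 * l - 2) *: v | v in [set: 'rV[A]_(2 * n)]] in
  let Bot := fixed_by S nV in
  exists modBot : mxmodule W Bot,
  let Top := factmod_repr modBot in
  let Top_ (phi : Irr C N) := joint_eigenspace Top N (irr_mode phi) in
  [/\ #|norm_one star| = (2 * q ^ (l - 1))%N,
      #|Irr C N| = #|norm_one star|,
      mult_free_decomposition Top 1%:M Top_,
      exists2 B : 'I_(2 * \sum_(i < l - 1) q ^ i) -> 'M[C]_d,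
        mult_free_decomposition W Bot B
        & forall j phi (modB : mxmodule W (B j))
                 (modT : mxmodule Top (Top_ phi)),
            ~ mx_rsim (submod_repr modB) (submod_repr modT)
    & exists (chi : {perm 'rV[A]_(2 * n)} -> C) (mu : Rbar -> C)
             (Sbar : mx_representation C [set: heisenberg fbar] (\rank Bot))
             (Wbar : mx_representation C (unitary_group hbar) (\rank Bot)),
        [/\ lin_char (unitary_group h) chi, primitive_char mu,
            schrodinger Sbar mu, weil Sbar Wbar
          & forall g, g \in unitary h ->
            exists gbar,
              [/\ gbar \in unitary hbar,
                  forall v, gbar (map_mx piA v) = map_mx piA (g v)
                & submod_repr modBot g = chi g *: Wbar gbar]]].
Proof.
move=> q N nV Bot.
have ram := ramified_quotient O_local O_not_field residueP F_odd l_gt1 rhoRP rhoAP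
  iotaE star_R star_pi.
have m_gt0 : (0 < 2 * n)%N by rewrite muln_gt0.
have modBot : mxmodule W Bot.
  exact: (bot_module ram m_gt0 h_skew fE lambda_prim S_lambda W_weil).
exists modBot => Top Top_.
have cNN : abelian N by apply: norm_one_abelian.
have [topD top_bot] := top_decomposition ram m_gt0 h_skew h_nondeg fE lambda_prim
  S_lambda W_weil.
have [B botD Bprop] := bot_decomposition ram m_gt0 h_skew h_nondeg fE lambda_prim
  S_lambda W_weil.
(* The factor module depends on the proof that Bot is a submodule; the two proofs are identified
   here. *)
rewrite (bool_irrelevance (bot_module _ _ _ _ _ _ _) modBot) in topD top_bot.
split.
- exact: (card_norm_one ram).
- by rewrite (card_Irr_abelian C cNN) (card_norm_one_scalars star m_gt0).
- exact: topD.
- by exists B => // j phi modB modT; apply: top_bot (Bprop j).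
have [lambda0 lambdaD] := proj1 lambda_prim.
have thD (a b : 'rV[A]_(2 * n)) : rhoA 'qX ^+ (2 * l - 2) *: (a + b) =
    rhoA 'qX ^+ (2 * l - 2) *: a + rhoA 'qX ^+ (2 * l - 2) *: b.
  exact: scalerDr.
have th_iso (a b : 'rV[A]_(2 * n)) :
    f (rhoA 'qX ^+ (2 * l - 2) *: a) (rhoA 'qX ^+ (2 * l - 2) *: b) = 0.
  by apply: (alt_pi0 ram h_skew fE); lia.
have nondeg := alt_nondeg ram h_skew h_nondeg fE lambda_prim.
have fixBot k (X : 'M[C]_(k, d)) : (X <= Bot)%MS <->
    forall v, X *m S (heis f 0 (rhoA 'qX ^+ (2 * l - 2) *: v)) = X.
  split=> [/rfix_mxP XB v|XB]; first by apply/XB/imset_f/imset_f.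
  by apply/rfix_mxP => _ /imsetP[_ /imsetP[v _ ->] ->].
pose iB : 'M[C]_(\rank Bot, d) := val_submod (U := Bot) 1%:M.
pose kB : 'M[C]_(d, \rank Bot) := in_submod Bot 1%:M.
have iBkB : iB *m kB = 1%:M by rewrite -in_submodE; apply: val_submodK.
have iB_fix : forall v, iB *m S (heis f 0 (rhoA 'qX ^+ (2 * l - 2) *: v)) = iB.
  by apply/fixBot; rewrite val_submod1.
have kBiB k (X : 'M[C]_(k, d)) :
    (forall v, X *m S (heis f 0 (rhoA 'qX ^+ (2 * l - 2) *: v)) = X) -> X *m kB *m iB = X.
  by move=> /fixBot XB; rewrite -in_submodE -val_submodE in_submodK.
(* The projector P of the compression is the average over pi^(2l-2) V, and [iB], [kB] are the
   inclusion of Bot and its coordinate map. *)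
have [chi [mub [Sb [Wb [chiL mub_prim Sb_irr Wb_weil WbE]]]]] :=
  bottom_weil ram m_gt0 h_skew h_nondeg fE piRP piAP hbarE fbarE lambda_prim S_lambda
    W_weil iBkB iB_fix kBiB
    (heis_avg_neq0 lambda0 lambdaD S_lambda nondeg thD)
    (heis_avg_mul lambda0 S_lambda thD th_iso)
    (mul_heis_avg lambda0 S_lambda thD th_iso)
    (fun k X XT => elimT eqP (introT (heis_avgP lambda0 S_lambda thD th_iso X) XT)).
exists chi, mub, Sb, Wb; split=> // g Ug.
have [gbar [Ugbar gbarE cornerE]] := WbE g Ug; exists gbar; split=> //.
by rewrite -cornerE; apply: in_submodE.
Qed.
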